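(* Let $(X_i,Y_i,Z_i)_{i\ge1}$ be i.i.d. copies of $(X,Y,Z)$ and, for each $n$, let $\hat p^*(x,y,z)=\frac1n\sum_{i=1}^n\mathbb I(X_i^*=x,Y_i=y,Z_i=z)$, where $(X_i^*,Y_i,Z_i)_{i=1}^n$ is obtained by the Conditional Randomisation scheme. Then, conditionally on $(X_i,Y_i,Z_i)_{i=1}^\infty$, for almost all such sequences, as $n\to\infty$, $$\sqrt n\,\big(\hat p^*(x,y,z)-p(x|z)\hat p(y|z)\hat p(z)\big)_{x,y,z}\xrightarrow{d}N(0,\tilde\Sigma),$$ where $$\tilde\Sigma_{x,y,z}^{x',y',z'}=\mathbb I(y=y',z=z')\big(\mathbb I(x=x')p(x|z)p(y|z)p(z)-p(x|z)p(x'|z')p(y|z)p(z)\big).$$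
   Context: $(X,Y,Z)$ is a discrete random triple with values in $\mathcal X\times\mathcal Y\times\mathcal Z$ (finite sets), with $p(x,y,z)=P(X=x,Y=y,Z=z)>0$ for all $(x,y,z)$; $p(z)=P(Z=z)$, $p(x|z)=P(X=x|Z=z)$, $p(y|z)=P(Y=y|Z=z)$. $X$ and $Y$ are not assumed conditionally independent given $Z$. $\mathbb I$ denotes the indicator. $\hat p(y|z)=n(y,z)/n(z)$ and $\hat p(z)=n(z)/n$, where $n(y,z)=\sum_{i=1}^n\mathbb I(Y_i=y,Z_i=z)$ and $n(z)=\sum_{i=1}^n\mathbb I(Z_i=z)$. $\tilde\Sigma_{x,y,z}^{x',y',z'}$ is the entry of $\tilde\Sigma$ with row index $(x,y,z)$ and column index $(x',y',z')$. Conditional Randomisation (CR) scheme: the conditional distribution $P_{X|Z}$ is known; conditionally on the data $(X_i,Y_i,Z_i)_{i\ge1}$, the variables $X_1^*,\dots,X_n^*$ are independent and $X_i^*$ is drawn from $P_{X|Z=Z_i}$, i.e. $P(X_i^*=x\mid \text{data})=p(x|Z_i)$. The resampled sample is $(X_i^*,Y_i,Z_i)_{i=1}^n$. *)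

(* Defs.v *)
From mathcomp Require Import all_boot all_order all_algebra.
From mathcomp Require Import all_classical all_reals all_analysis.

Set Implicit Arguments.
Unset Strict Implicit.
Unset Printing Implicit Defensive.

Import Order.TTheory GRing.Theory Num.Theory.
Import numFieldNormedType.Exports.

Local Open Scope classical_set_scope.
Local Open Scope ring_scope.

Definition borel_cV (R : realType) (d : nat)
  : measurableType (@open 'cV[R]_d).-sigma :=
  g_sigma_algebraType (@open 'cV[R]_d).

Definition weak_cvg (R : realType) (d : nat)
    (mu_ : nat -> {measure set (borel_cV R d) -> \bar R})
    (mu : {measure set (borel_cV R d) -> \bar R}) : Prop :=
  forall f : 'cV[R]_d -> R, continuous f ->
    (exists M : R, forall v, `|f v| <= M) ->
    (\int[mu_ n]_v (f v)%:E)%E @[n --> \oo] --> (\int[mu]_v (f v)%:E)%E.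

(* The library's [normal_prob m 0] is a uniform law, hence the case split; the
   second argument of [normal_prob] is the standard deviation. *)
Definition normal_law (R : realType) (m v : R) : set R -> \bar R :=
  if v == 0 then \d_m else normal_prob m (Num.sqrt v).

(* [mu] is N(m, S), possibly degenerate: S is symmetric positive semidefinite
   and every linear functional t^T v is N(t^T m, t^T S t). *)
Definition is_mvnormal (R : realType) (d : nat)
    (mu : probability (borel_cV R d) R) (m : 'cV[R]_d) (S : 'M[R]_d) : Prop :=
  S^T = S /\
  forall t : 'cV[R]_d,
    0 <= (t^T *m S *m t) 0 0 /\
    forall A : set R, measurable A ->
      mu [set v : 'cV[R]_d | A ((t^T *m v) 0 0)] =
      normal_law ((t^T *m m) 0 0) ((t^T *m S *m t) 0 0) A.

(* [q] is a version of P(A | <<s G>>). *)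
Definition is_cond_prob (R : realType) (dO : measure_display)
    (O : measurableType dO) (P : probability O R) (G : set (set O))
    (A : set O) (q : O -> R) : Prop :=
  measurable_fun [set: g_sigma_algebraType G] (q : g_sigma_algebraType G -> R)
  /\ forall D : set O, <<s G >> D ->
       (\int[P]_(w in D) (q w)%:E = P (D `&` A))%E.

(* [kappa] is a regular conditional distribution of V given <<s G>>. *)
Definition is_cond_law (R : realType) (dO : measure_display)
    (O : measurableType dO) (P : probability O R) (G : set (set O))
    (d : nat) (V : O -> 'cV[R]_d)
    (kappa : R.-pker (g_sigma_algebraType G) ~> (borel_cV R d)) : Prop :=
  forall (D : set O) (B : set (borel_cV R d)), <<s G >> D -> measurable B ->
    (\int[P]_(w in D) kappa w B = P (D `&` V @^-1` B))%E.

(* Conditionally on <<s G>>, for almost all outcomes, V_n converges in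
   distribution to mu. Regular conditional distributions are unique only up to
   null sets, so the convergence is required for all versions; the first
   conjunct says that versions exist. *)
Definition cond_cvg_dist (R : realType) (dO : measure_display)
    (O : measurableType dO) (P : probability O R) (G : set (set O))
    (d : nat) (V : nat -> O -> 'cV[R]_d)
    (mu : probability (borel_cV R d) R) : Prop :=
  (exists kappa : nat -> R.-pker (g_sigma_algebraType G) ~> (borel_cV R d),
     forall n, is_cond_law P (V n) (kappa n)) /\
  forall kappa : nat -> R.-pker (g_sigma_algebraType G) ~> (borel_cV R d),
    (forall n, is_cond_law P (V n) (kappa n)) ->
    {ae P, forall w : O, weak_cvg (fun n => kappa n w) mu}.

Definition discrete_rv (dO : measure_display) (O : measurableType dO)
    (T : finType) (W : O -> T) : Prop :=
  forall t : T, measurable (W @^-1` [set t]).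

Definition triple (O TX TY TZ : Type) (X : O -> TX) (Y : O -> TY) (Z : O -> TZ)
  : O -> TX * TY * TZ := fun w => (X w, Y w, Z w).

(* The W_i are i.i.d. copies of W0; W0 may live on another space. *)
Definition iid_copies (R : realType) (d0 dO : measure_display)
    (O0 : measurableType d0) (O : measurableType dO)
    (P0 : probability O0 R) (P : probability O R) (T : finType)
    (W0 : O0 -> T) (W : nat -> O -> T) : Prop :=
  [/\ forall i, discrete_rv (W i),
      forall i (A : set T), P (W i @^-1` A) = P0 (W0 @^-1` A)
    & forall (J : seq nat) (A : nat -> set T), uniq J ->
        P (\bigcap_(i in [set` J]) (W i @^-1` A i)) =
        (\prod_(i <- J) P (W i @^-1` A i))%E].

(* Generates the sigma-algebra of the whole data sequence (W_i)_i. *)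
Definition data_events (O : Type) (T : finType) (W : nat -> O -> T)
  : set (set O) := [set A | exists i t, A = W i @^-1` [set t]].

Section Laws.
Context (R : realType) (d0 : measure_display) (O0 : measurableType d0).
Variables (P0 : probability O0 R) (TX TY TZ : finType).
Variables (X : O0 -> TX) (Y : O0 -> TY) (Z : O0 -> TZ).

Definition p_xyz (x : TX) (y : TY) (z : TZ) : R :=
  fine (P0 [set w | [/\ X w = x, Y w = y & Z w = z]]).
Definition p_z (z : TZ) : R := fine (P0 [set w | Z w = z]).
Definition p_x_z (x : TX) (z : TZ) : R :=
  fine (P0 [set w | X w = x /\ Z w = z]) / p_z z.
Definition p_y_z (y : TY) (z : TZ) : R :=
  fine (P0 [set w | Y w = y /\ Z w = z]) / p_z z.

Definition Sigma_tilde_entry (u v : TX * TY * TZ) : R :=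
  let: (x, y, z) := u in let: (x', y', z') := v in
  ((y == y') && (z == z'))%:R *
  ((x == x')%:R * p_x_z x z * p_y_z y z * p_z z
   - p_x_z x z * p_x_z x' z' * p_y_z y z * p_z z).

(* Vectors and matrices indexed by triples are re-indexed along [enum_val]. *)
Definition Sigma_tilde : 'M[R]_#|{: TX * TY * TZ}| :=
  \matrix_(i, j) Sigma_tilde_entry (enum_val i) (enum_val j).

End Laws.

Section Sample.
Context (R : realType) (O : Type) (TX TY TZ : finType).
Variables (Ys : nat -> O -> TY) (Zs : nat -> O -> TZ).
Variables (Xstar : forall n : nat, 'I_n -> O -> TX).

Definition n_z (n : nat) (z : TZ) (w : O) : nat :=
  (\sum_(i < n) (Zs i w == z))%N.
Definition n_yz (n : nat) (y : TY) (z : TZ) (w : O) : nat :=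
  (\sum_(i < n) ((Ys i w == y) && (Zs i w == z)))%N.
Definition phat_z (n : nat) (z : TZ) (w : O) : R := (n_z n z w)%:R / n%:R.
(* 0 when n(z) = 0, as x / 0 = 0. *)
Definition phat_y_z (n : nat) (y : TY) (z : TZ) (w : O) : R :=
  (n_yz n y z w)%:R / (n_z n z w)%:R.
Definition phat_star (n : nat) (x : TX) (y : TY) (z : TZ) (w : O) : R :=
  n%:R^-1 *
  \sum_(i < n) [&& @Xstar n i w == x, Ys i w == y & Zs i w == z]%:R.

Definition CR_vector (pxz : TX -> TZ -> R) (n : nat) (w : O)
  : 'cV[R]_#|{: TX * TY * TZ}| :=
  \col_j let: (x, y, z) := enum_val j in
    Num.sqrt n%:R *
    (phat_star n x y z w - pxz x z * phat_y_z n y z w * phat_z n z w).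

End Sample.

(* [Xstar n i] is X^*_{i+1} of the n-th resample and G generates the data.
   The last clause is conditional independence: the product of any versions of
   the marginal conditional probabilities is a version of the joint one. *)
Definition CR_scheme (R : realType) (dO : measure_display)
    (O : measurableType dO) (P : probability O R) (G : set (set O))
    (TX TZ : finType) (pxz : TX -> TZ -> R) (Zs : nat -> O -> TZ)
    (Xstar : forall n : nat, 'I_n -> O -> TX) : Prop :=
  forall n : nat,
  [/\ forall i : 'I_n, discrete_rv (Xstar n i),
      forall (i : 'I_n) (x : TX),
        is_cond_prob P G (Xstar n i @^-1` [set x]) (fun w => pxz x (Zs i w))
    & forall q : 'I_n -> TX -> O -> R,
        (forall i x, is_cond_prob P G (Xstar n i @^-1` [set x]) (q i x)) ->
        forall x : 'I_n -> TX,
          is_cond_prob P G [set w | forall i, Xstar n i w = x i]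
            (fun w => \prod_(i < n) q i (x i) w)].

(* Main.v *)
Require Import Defs.
From HB Require Import structures.
From mathcomp Require Import all_boot all_order all_algebra.
From mathcomp Require Import all_classical all_reals all_analysis.
From mathcomp Require Import measurable_realfun ring lra zify.

(** Write V_n for the vector of the statement. Since p^(y|z) p^(z) is n(y,z)/n,
    also when n(z) = 0, V_n is n^(-1/2) times a sum over the observations i of
    the indicator vector of (X*_i, Y_i, Z_i) minus its mean when X*_i has law
    p(.|Z_i) ([CR_vectorE]). With the data fixed, the resampled variables are
    independent, so V_n is a normalised sum of independent, centred, uniformly
    bounded vectors, and the theorem is a central limit theorem along almost
    every data sequence.

    Fixed data. Let t be a direction. The variance of t.V_n is the sum over
    (y, z) of n(y,z)/n times the variance of t(X, y, z) under p(.|z); it depends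
    on the data through the empirical frequencies only and, as soon as these
    converge to p(y, z), it converges to t^T Sigma t ([Sigma_quadratic]: Sigma is
    block diagonal in (y, z), with the multinomial covariance of p(.|z), scaled
    by p(y, z), as blocks). Replacing the summands of t.V_n one at a time by
    Gaussian multipliers then gives the limit of the average of cos(t.V_n + th)
    ([avg_cos_bound], [char_resample_cvg]). The frequencies converge almost
    surely by the strong law for pairwise independent events
    ([strong_law_events], [frequency_cvg]).

    From characteristic functions to weak convergence. Coordinates of V_n have
    variance at most 1, so the laws are tight ([resample_box_tail]). On a box, a
    continuous function bounded by M is uniformly approximated by trigonometric
    polynomials which are bounded by M everywhere ([trigpoly_approx]): after the
    change of variable s_k = sin (v_k / 2L), one takes the Bernstein-type average
    of the function over random estimates of s whose sampling weights are affine
    in s. Convergence of characteristic functions and tightness therefore imply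
    weak convergence ([char_weak_cvg]). The same result, applied to a constant
    sequence in dimension 1, shows that a law on the line is determined by its
    characteristic function ([eq_char_eq_measure]).

    The limit law. The characteristic function of N(0, s^2) solves a first-order
    linear differential equation ([integral_cos_normal_pdf]). Adding independent
    standard normal multiples of the vectors of an explicit square root of Sigma
    ([root_vec]) gives a law on vectors whose characteristic function is the
    expected one ([gaussian_exists]); its projections are the required,
    possibly degenerate, normal laws by uniqueness on the line
    ([mvnormal_exists]).

    Conditioning. Data and resample of size n take finitely many values, so the
    conditional law of V_n is an explicit finite mixture, with the products
    of the p(x_i|Z_i) as weights. Any version of the conditional law is almost
    surely equal to this mixture as a measure ([cond_law_mixture]), hence the
    result for fixed data applies to every version, outside a countable union of
    null sets ([CR_cond_cvg]). *)

Set Implicit Arguments.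
Unset Strict Implicit.
Unset Printing Implicit Defensive.

Import Order.TTheory GRing.Theory Num.Theory.
Import numFieldNormedType.Exports.

Local Open Scope classical_set_scope.
Local Open Scope ring_scope.

(** * Averages over finite product spaces *)

Section FiniteProduct.
Context (R : realType) (T : finType).
Implicit Types (q : nat -> T -> R) (h : nat -> T -> R).

(** The mean of [F] when the coordinates are independent with laws [q i]. The
    laws are indexed by all of [nat] so that samples of different sizes share
    them and induction on the size is possible. *)
Definition avg n q (F : {ffun 'I_n -> T} -> R) : R :=
  \sum_(x : {ffun 'I_n -> T}) (\prod_(i < n) q i (x i)) * F x.

Definition ffun_snoc n (x : {ffun 'I_n -> T}) (t : T) : {ffun 'I_n.+1 -> T} :=
  [ffun i => if unlift ord_max i is Some j then x j else t].

Lemma ffun_snoc_max n (x : {ffun 'I_n -> T}) t : ffun_snoc x t ord_max = t.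
Proof. by rewrite ffunE unlift_none. Qed.

Lemma ffun_snoc_widen n (x : {ffun 'I_n -> T}) t (i : 'I_n) :
  ffun_snoc x t (widen_ord (leqnSn n) i) = x i.
Proof.
rewrite ffunE; have -> : widen_ord (leqnSn n) i = lift ord_max i.
  by apply/val_inj; rewrite /= /bump leqNgt ltn_ord.
by rewrite liftK.
Qed.

Lemma sum_ffun_snoc n (G : {ffun 'I_n.+1 -> T} -> R) :
  \sum_(x : {ffun 'I_n.+1 -> T}) G x =
  \sum_t \sum_(x : {ffun 'I_n -> T}) G (ffun_snoc x t).
Proof.
rewrite pair_big /= (reindex (fun p : T * {ffun 'I_n -> T} => ffun_snoc p.2 p.1)) //=.
exists (fun y : {ffun 'I_n.+1 -> T} =>
  (y ord_max, [ffun i : 'I_n => y (widen_ord (leqnSn n) i)])) => [[t x] _|y _] /=.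
  by rewrite ffun_snoc_max; congr pair; apply/ffunP => i; rewrite ffunE ffun_snoc_widen.
apply/ffunP => i; rewrite ffunE; case: unliftP => [j ->|->] //; rewrite ffunE.
by congr (y _); apply/val_inj; rewrite /= /bump leqNgt ltn_ord.
Qed.

(** Integrates out the last coordinate. The free shift [a] absorbs its
    contribution, which leaves an average of the same shape. *)
Lemma avgS n q h (phi : R -> R) a :
  avg q (fun x : {ffun 'I_n.+1 -> T} => phi (a + \sum_(i < n.+1) h i (x i))) =
  \sum_t q n t *
    avg q (fun x : {ffun 'I_n -> T} => phi (a + h n t + \sum_(i < n) h i (x i))).
Proof.
rewrite /avg sum_ffun_snoc; apply: eq_bigr => t _.
rewrite mulr_sumr; apply: eq_bigr => x _.
rewrite !big_ord_recr /= ffun_snoc_max.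
have -> : \prod_(i < n) q i (ffun_snoc x t (widen_ord (leqnSn n) i)) =
  \prod_(i < n) q i (x i) by apply: eq_bigr => i _; rewrite ffun_snoc_widen.
have -> : \sum_(i < n) h i (ffun_snoc x t (widen_ord (leqnSn n) i)) =
  \sum_(i < n) h i (x i) by apply: eq_bigr => i _; rewrite ffun_snoc_widen.
by rewrite mulrA [_ * q n t]mulrC addrA addrAC.
Qed.

Lemma avg0 q h (phi : R -> R) a :
  avg q (fun x : {ffun 'I_0 -> T} => phi (a + \sum_(i < 0) h i (x i))) = phi a.
Proof.
rewrite /avg.
under eq_bigr do rewrite !big_ord0 mul1r addr0.
by rewrite big_const card_ffun card_ord expn0 /= addr0.
Qed.

Section Weights.
Variable q : nat -> T -> R.
Hypothesis q_ge0 : forall i t, 0 <= q i t.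
Hypothesis q_sum1 : forall i, \sum_t q i t = 1.

Lemma avg_cst n c : avg q (fun _ : {ffun 'I_n -> T} => c) = c.
Proof.
rewrite /avg -mulr_suml -(bigA_distr_bigA (fun (i : 'I_n) t => q i t)).
by rewrite big1 ?mul1r.
Qed.

Lemma weight_ge0 n (x : {ffun 'I_n -> T}) : 0 <= \prod_(i < n) q i (x i).
Proof. exact: prodr_ge0. Qed.

Lemma ler_avg n (F G : {ffun 'I_n -> T} -> R) :
  (forall x, F x <= G x) -> avg q F <= avg q G.
Proof. by move=> FG; apply: ler_sum => x _; rewrite ler_wpM2l ?weight_ge0. Qed.

Lemma avgD n (F G : {ffun 'I_n -> T} -> R) :
  avg q (fun x => F x + G x) = avg q F + avg q G.
Proof. by rewrite /avg -big_split /=; apply: eq_bigr => x _; rewrite mulrDr. Qed.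

Lemma avgZ n c (F : {ffun 'I_n -> T} -> R) :
  avg q (fun x => c * F x) = c * avg q F.
Proof. by rewrite /avg mulr_sumr; apply: eq_bigr => x _; rewrite mulrCA. Qed.

Lemma avg_sum n (I : finType) (F : I -> {ffun 'I_n -> T} -> R) :
  avg q (fun x => \sum_k F k x) = \sum_k avg q (F k).
Proof.
rewrite /avg exchange_big /=; apply: eq_bigr => x _.
by rewrite mulr_sumr.
Qed.

Lemma ler_norm_avg n (F : {ffun 'I_n -> T} -> R) :
  `|avg q F| <= avg q (fun x => `|F x|).
Proof.
apply: le_trans (ler_norm_sum _ _ _) _; apply: ler_sum => x _.
by rewrite normrM ger0_norm ?weight_ge0.
Qed.

Variable h : nat -> T -> R.
Hypothesis h_mean0 : forall i, \sum_t q i t * h i t = 0.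

(** Cross terms vanish because the coordinates are independent and centred;
    the constant [a] is what makes the induction on [n] go through. *)
Lemma avg_sqr n a :
  avg q (fun x : {ffun 'I_n -> T} => (a + \sum_(i < n) h i (x i)) ^+ 2) =
  a ^+ 2 + \sum_(i < n) \sum_t q i t * h i t ^+ 2.
Proof.
elim: n a => [|n IHn] a.
  by rewrite (avg0 q h (fun y => y ^+ 2)) big_ord0 addr0.
rewrite (avgS n q h (fun y => y ^+ 2)) big_ord_recr /=.
under eq_bigr do rewrite IHn.
rewrite (eq_bigr (fun t => (a ^+ 2 + \sum_(i < n) \sum_t q i t * h i t ^+ 2) * q n t
   + 2 * a * (q n t * h n t) + q n t * h n t ^+ 2)); last by move=> t _; ring.
by rewrite !big_split /= -!mulr_sumr q_sum1 h_mean0; ring.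
Qed.

End Weights.
End FiniteProduct.

(** * Taylor bounds *)

Section TaylorTrig.
Context (R : realType).
Implicit Type x : R.

(** The Taylor bounds below follow from one another by integrating from 0. *)
Lemma ge0_from_derive (f f' : R -> R) :
  (forall x, is_derive x (1 : R) f (f' x)) -> f 0 = 0 ->
  (forall x, 0 <= x -> 0 <= f' x) -> forall x, 0 <= x -> 0 <= f x.
Proof.
move=> df f0 f'0 x; rewrite le_eqVlt => /predU1P[<-|x0]; first by rewrite f0.
have [c|c + fE] := @MVT _ f f' 0 x x0 (fun y _ => df y).
  by apply: derivable_within_continuous => y _; exact: ex_derive.
rewrite in_itv /= => /andP[c0 cx].
by move: fE; rewrite f0 !subr0 => ->; rewrite mulr_ge0 ?f'0 // ltW.
Qed.

Lemma sin_le_id x : 0 <= x -> sin x <= x.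
Proof.
move=> x0; rewrite -subr_ge0.
have D y : is_derive y (1 : R) (fun y => y - sin y) (1 - cos y).
  exact: is_deriveB.
apply: (ge0_from_derive D _ _ x0) => [|y _]; first by rewrite sin0 subr0.
by rewrite subr_ge0 cos_le1.
Qed.

Lemma cos_ge_quad x : 0 <= x -> 1 - x ^+ 2 / 2 <= cos x.
Proof.
move=> x0; rewrite -subr_ge0.
have D y : is_derive y (1 : R) (fun y => cos y - (1 - y ^+ 2 / 2)) (y - sin y).
  by apply: is_derive_eq; rewrite /GRing.scale /=; field.
apply: (ge0_from_derive D _ _ x0) => [|y y0]; last by rewrite subr_ge0 sin_le_id.
by rewrite cos0 expr0n /= mul0r !subr0 subrr.
Qed.

Lemma sin_ge_cubic x : 0 <= x -> x - x ^+ 3 / 6 <= sin x.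
Proof.
move=> x0; rewrite -subr_ge0.
have D y : is_derive y (1 : R) (fun y => sin y - (y - y ^+ 3 / 6))
    (cos y - (1 - y ^+ 2 / 2)).
  by apply: is_derive_eq; rewrite /GRing.scale /=; field.
apply: (ge0_from_derive D _ _ x0) => [|y y0]; last by rewrite subr_ge0 cos_ge_quad.
by rewrite sin0 expr0n /= mul0r !subr0.
Qed.

Lemma cos_le_quartic x : 0 <= x -> cos x <= 1 - x ^+ 2 / 2 + x ^+ 4 / 24.
Proof.
move=> x0; rewrite -subr_ge0.
have D y : is_derive y (1 : R) (fun y => 1 - y ^+ 2 / 2 + y ^+ 4 / 24 - cos y)
    (sin y - (y - y ^+ 3 / 6)).
  by apply: is_derive_eq; rewrite /GRing.scale /=; field.
apply: (ge0_from_derive D _ _ x0) => [|y y0]; last by rewrite subr_ge0 sin_ge_cubic.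
by rewrite cos0 !expr0n /= !mul0r subr0 addr0 subrr.
Qed.

Lemma cos_taylor x : `|cos x - (1 - x ^+ 2 / 2)| <= `|x| ^+ 4.
Proof.
wlog x0 : x / 0 <= x.
  move=> H; have [/H//|/ltW] := leP 0 x; rewrite -oppr_ge0 => /H.
  by rewrite normrN cosN sqrrN.
rewrite (ger0_norm x0); have := cos_ge_quad x0; have := cos_le_quartic x0.
have : 0 <= x ^+ 4 by rewrite exprn_ge0.
by move=> *; rewrite ler_norml; apply/andP; split; lra.
Qed.

Lemma sin_taylor x : `|sin x - x| <= `|x| ^+ 3.
Proof.
wlog x0 : x / 0 <= x.
  move=> H; have [/H//|/ltW] := leP 0 x; rewrite -oppr_ge0 => /H.
  by rewrite normrN sinN -opprD normrN.
rewrite (ger0_norm x0); have := sin_ge_cubic x0; have := sin_le_id x0.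
have : 0 <= x ^+ 3 by rewrite exprn_ge0.
by move=> *; rewrite ler_norml; apply/andP; split; lra.
Qed.

Lemma expRN_taylor x : 0 <= x -> `|expR (- x) - (1 - x)| <= x ^+ 2.
Proof.
move=> x0; have x1 : 0 < 1 + x by lra.
have h1 := expR_ge1Dx (- x); have h2 := expR_ge1Dx x.
have : expR (- x) <= (1 + x)^-1 by rewrite expRN lef_pV2 ?posrE ?expR_gt0.
have : (1 + x)^-1 <= 1 - x + x ^+ 2.
  rewrite -[leLHS]mul1r ler_pdivrMr //.
  have : 0 <= x ^+ 3 by rewrite exprn_ge0.
  have -> : (1 - x + x ^+ 2) * (1 + x) = 1 + x ^+ 3 by ring.
  lra.
move=> *; rewrite ler_norml; have := sqr_ge0 x => ?; apply/andP; split; lra.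
Qed.

End TaylorTrig.

(** * Lindeberg replacement for cosines *)

Section CosineAverage.
Context (R : realType) (T : finType) (q h : nat -> T -> R) (b : R).
Hypothesis q_ge0 : forall i t, 0 <= q i t.
Hypothesis q_sum1 : forall i, \sum_t q i t = 1.
Hypothesis h_mean0 : forall i, \sum_t q i t * h i t = 0.
Hypothesis h_le : forall i t, `|h i t| <= b.

Let var i := \sum_t q i t * h i t ^+ 2.

Lemma var_ge0 i : 0 <= var i.
Proof. by apply: sumr_ge0 => t _; rewrite mulr_ge0 // sqr_ge0. Qed.

Lemma weighted_le (g : T -> R) c i : (forall t, `|g t| <= c) ->
  `|\sum_t q i t * g t| <= c.
Proof.
move=> gc; apply: le_trans (ler_norm_sum _ _ _) _.
rewrite -[leRHS]mul1r -(q_sum1 i) mulr_suml; apply: ler_sum => t _.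
by rewrite normrM (ger0_norm (q_ge0 i t)) ler_wpM2l.
Qed.

(** The first-order terms vanish because [h i] is centred, the second-order
    ones agree on both sides, so only Taylor remainders are left. *)
Lemma cos_step_bound i th :
  `|\sum_t q i t * cos (th + h i t) - expR (- (var i / 2)) * cos th|
    <= b ^+ 3 + 2 * b ^+ 4.
Proof.
pose A := \sum_t q i t * (cos (h i t) - (1 - h i t ^+ 2 / 2)).
pose B := \sum_t q i t * (sin (h i t) - h i t).
pose C := expR (- (var i / 2)) - (1 - var i / 2).
have -> : \sum_t q i t * cos (th + h i t) - expR (- (var i / 2)) * cos th =
    cos th * A - sin th * B - cos th * C.
  have EA : A = \sum_t q i t * cos (h i t) - 1 + var i / 2.
    rewrite /A (eq_bigr (fun t => q i t * cos (h i t) - q i t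
      + q i t * h i t ^+ 2 / 2)) => [|t _]; last by field.
    by rewrite big_split sumrB q_sum1 -mulr_suml.
  have EB : B = \sum_t q i t * sin (h i t).
    rewrite /B (eq_bigr (fun t => q i t * sin (h i t) - q i t * h i t)) => [|t _].
      by rewrite sumrB h_mean0 subr0.
    by ring.
  have -> : \sum_t q i t * cos (th + h i t) =
      cos th * (\sum_t q i t * cos (h i t)) - sin th * B.
    rewrite EB !mulr_sumr -sumrB; apply: eq_bigr => t _.
    by rewrite cosD; ring.
  by rewrite EA /C; ring.
have cos1 := @cos_le1 R th; have cosN1 := @cos_geN1 R th.
have sin1 := @sin_le1 R th; have sinN1 := @sin_geN1 R th.
have nb t : 0 <= `|h i t| by [].
have hA : `|A| <= b ^+ 4.
  apply: weighted_le => t; apply: le_trans (cos_taylor _) _.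
  by rewrite lerXn2r ?nnegrE // (le_trans _ (h_le i t)).
have hB : `|B| <= b ^+ 3.
  apply: weighted_le => t; apply: le_trans (sin_taylor _) _.
  by rewrite lerXn2r ?nnegrE // (le_trans _ (h_le i t)).
have hC : `|C| <= b ^+ 4.
  have v0 := var_ge0 i; have v2 : 0 <= var i / 2 by rewrite divr_ge0.
  apply: le_trans (expRN_taylor v2) _.
  have vb : `|var i| <= b ^+ 2.
    apply: weighted_le => t; rewrite normrX.
    by rewrite lerXn2r ?nnegrE // (le_trans _ (h_le i t)).
  rewrite ger0_norm // in vb.
  rewrite (_ : 4 = 2 * 2)%N // exprM lerXn2r ?nnegrE ?sqr_ge0 //.
  lra.
have mulle (u v w : R) : -1 <= u -> u <= 1 -> `|v| <= w -> `|u * v| <= w.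
  move=> u1 u2 vw; apply: le_trans vw; rewrite normrM -[leRHS]mul1r.
  by rewrite ler_wpM2r // ler_norml u1.
have := mulle _ _ _ cosN1 cos1 hA; have := mulle _ _ _ sinN1 sin1 hB.
have := mulle _ _ _ cosN1 cos1 hC; rewrite !ler_norml.
by move=> /andP[? ?] /andP[? ?] /andP[? ?]; apply/andP; split; lra.
Qed.

(** Trotter's form of the Lindeberg argument: the summands are replaced one at
    a time by the Gaussian multiplier, and the replacement errors add up because
    both averaging over a coordinate and the multiplier are contractions. *)
Lemma avg_cos_bound n th :
  `|avg q (fun x : {ffun 'I_n -> T} => cos (th + \sum_(i < n) h i (x i)))
    - expR (- ((\sum_(i < n) var i) / 2)) * cos th|
  <= n%:R * (b ^+ 3 + 2 * b ^+ 4).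
Proof.
elim: n th => [|n IHn] th.
  by rewrite (avg0 q h cos) big_ord0 mul0r oppr0 expR0 mul1r subrr normr0 mul0r.
rewrite (avgS n q h cos) big_ord_recr /=.
set E := expR (- ((\sum_(i < n) var i) / 2)).
have -> : expR (- ((\sum_(i < n) var i + var n) / 2)) = E * expR (- (var n / 2)).
  by rewrite -expRD; congr expR; field.
set D := fun a => avg q (fun x : {ffun 'I_n -> T} => cos (a + \sum_(i < n) h i (x i))).
rewrite -/(D) (_ : _ - _ = \sum_t q n t * (D (th + h n t) - E * cos (th + h n t))
  + E * (\sum_t q n t * cos (th + h n t) - expR (- (var n / 2)) * cos th)); last first.
  rewrite [E * (_ - _)]mulrBr mulr_sumr addrA -big_split /=; congr (_ - _); last ring.
  by apply: eq_bigr => t _; rewrite /D; ring.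
rewrite -[n.+1%:R]natr1 mulrDl mul1r; apply: le_trans (ler_normD _ _) _.
apply: lerD; first by apply: weighted_le => t; exact: IHn.
apply: le_trans (cos_step_bound n th); rewrite normrM -[leRHS]mul1r ler_wpM2r //.
rewrite ger0_norm ?expR_ge0 // -[leRHS]expR0 ler_expR oppr_le0 divr_ge0 //.
by apply: sumr_ge0 => i _; exact: var_ge0.
Qed.

End CosineAverage.

(** * Trigonometric polynomials *)

Section TrigPoly.
Context (R : realType) (d : nat).
Implicit Types (f g : 'cV[R]_d -> R) (t v : 'cV[R]_d).

Definition dot t v : R := (t^T *m v) 0 0.

Lemma dotE t v : dot t v = \sum_k t k 0 * v k 0.
Proof. by rewrite /dot mxE; apply: eq_bigr => k _; rewrite mxE. Qed.

Lemma dotDl s t v : dot (s + t) v = dot s v + dot t v.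
Proof. by rewrite /dot linearD mulmxDl mxE. Qed.

Lemma dotNl t v : dot (- t) v = - dot t v.
Proof. by rewrite /dot linearN mulNmx mxE. Qed.

Lemma dotZl c t v : dot (c *: t) v = c * dot t v.
Proof. by rewrite /dot linearZ -scalemxAl mxE. Qed.

Lemma dotDr t v w : dot t (v + w) = dot t v + dot t w.
Proof. by rewrite /dot mulmxDr mxE. Qed.

Lemma dotZr c t v : dot t (c *: v) = c * dot t v.
Proof. by rewrite /dot -scalemxAr mxE. Qed.

Lemma dot0l v : dot 0 v = 0.
Proof. by rewrite /dot trmx0 mul0mx mxE. Qed.

Lemma dot0r t : dot t 0 = 0.
Proof. by rewrite /dot mulmx0 mxE. Qed.

Lemma dot_continuous t : continuous (dot t).
Proof.
rewrite (_ : dot t = fun v => \sum_k t k 0 * v k 0); last first.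
  by apply/funext => v; rewrite dotE.
apply: continuous_big => [|k _]; first exact: add_continuous.
move=> v; apply: (@cvgM R _ (nbhs v) _ (fun=> t k 0) (fun v : 'cV[R]_d => v k 0)).
  exact: cvg_cst.
exact: coord_continuous.
Qed.

(** With a free phase, cosines play the part of the real and imaginary parts
    of the characters, and are stable under product up to linear combination. *)
Inductive trigpoly : ('cV[R]_d -> R) -> Prop :=
| trigpoly_cos t th : trigpoly (fun v => cos (dot t v + th))
| trigpolyD f g : trigpoly f -> trigpoly g -> trigpoly (fun v => f v + g v)
| trigpolyZ c f : trigpoly f -> trigpoly (fun v => c * f v).

Lemma trigpoly_cst c : trigpoly (fun=> c).
Proof.
have := trigpolyZ c (trigpoly_cos 0 0).
by congr trigpoly; apply/funext => v; rewrite dot0l addr0 cos0 mulr1.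
Qed.

Lemma trigpoly_sin t : trigpoly (fun v => sin (dot t v)).
Proof.
have := trigpoly_cos t (- (pi / 2)).
by congr trigpoly; apply/funext => v; rewrite cosBpihalf.
Qed.

Lemma trigpolyM f g : trigpoly f -> trigpoly g -> trigpoly (fun v => f v * g v).
Proof.
move=> tf tg; elim: tf => {f} [t th|f1 f2 _ IH1 _ IH2|c f _ IH]; first last.
- by have := trigpolyZ c IH; congr trigpoly; apply/funext => v; rewrite mulrA.
- by have := trigpolyD IH1 IH2; congr trigpoly; apply/funext => v; rewrite mulrDl.
elim: tg => {g} [s ph|g1 g2 _ IH1 _ IH2|c g _ IH].
- have := trigpolyD (trigpolyZ 2^-1 (trigpoly_cos (t + s) (th + ph)))
    (trigpolyZ 2^-1 (trigpoly_cos (t - s) (th - ph))).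
  congr trigpoly; apply/funext => v; rewrite !dotDl dotNl.
  rewrite (_ : dot t v + dot s v + (th + ph) = (dot t v + th) + (dot s v + ph)); last ring.
  rewrite (_ : dot t v - dot s v + (th - ph) = (dot t v + th) - (dot s v + ph)); last ring.
  by rewrite cosD cosB; field.
- by have := trigpolyD IH1 IH2; congr trigpoly; apply/funext => v; rewrite mulrDr.
- by have := trigpolyZ c IH; congr trigpoly; apply/funext => v; rewrite mulrCA.
Qed.

Lemma trigpoly_sum (I : Type) (r : seq I) (F : I -> 'cV[R]_d -> R) :
  (forall i, trigpoly (F i)) -> trigpoly (fun v => \sum_(i <- r) F i v).
Proof.
move=> tF; elim: r => [|i r IHr].
  by have := trigpoly_cst 0; congr trigpoly; apply/funext => v; rewrite big_nil.
by have := trigpolyD (tF i) IHr; congr trigpoly; apply/funext => v; rewrite big_cons.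
Qed.

Lemma trigpoly_prod (I : Type) (r : seq I) (F : I -> 'cV[R]_d -> R) :
  (forall i, trigpoly (F i)) -> trigpoly (fun v => \prod_(i <- r) F i v).
Proof.
move=> tF; elim: r => [|i r IHr].
  by have := trigpoly_cst 1; congr trigpoly; apply/funext => v; rewrite big_nil.
by have := trigpolyM (tF i) IHr; congr trigpoly; apply/funext => v; rewrite big_cons.
Qed.

Lemma trigpoly_continuous f : trigpoly f -> continuous f.
Proof.
elim => {f} [t th|f g _ cf _ cg|c f _ cf] v.
- apply: (continuous_comp (f := fun v => dot t v + th)); last exact: continuous_cos.
  exact: cvgD (@dot_continuous t v) (cvg_cst _).
- exact: cvgD (cf v) (cg v).
- exact: cvgM (cvg_cst _) (cf v).
Qed.

Lemma trigpoly_bounded f : trigpoly f -> exists M, forall v, `|f v| <= M.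
Proof.
elim => {f} [t th|f g _ [M fM] _ [N gN]|c f _ [M fM]].
- by exists 1 => v; rewrite ler_norml cos_geN1 cos_le1.
- by exists (M + N) => v; rewrite (le_trans (ler_normD _ _)) // lerD.
- by exists (`|c| * M) => v; rewrite normrM ler_wpM2l.
Qed.

End TrigPoly.

(** * Uniform approximation on boxes *)

Section HeineCantor.
Context (R : realType) (T : pseudoMetricType R).

(** Only [x] is confined to the compact set: the sample estimates of a point of
    the cube, to which this is applied, may fall outside the cube. *)
Lemma compact_uniform_continuous (K : set T) (f : T -> R) (e : R) :
  compact K -> continuous f -> 0 < e ->
  exists2 r, 0 < r & forall x y, K x -> ball x r y -> `|f x - f y| < e.
Proof.
move=> cK cf e0.
pose B (r : R) (x : T) := forall y, ball x r y -> `|f x - f y| < e.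
have : \forall r \near 0^'+, K `<=` B r.
  move/compact_near_coveringP : cK; apply => x Kx.
  have /cvgrPdist_lt /(_ (e / 2)) := cf x.
  rewrite divr_gt0 // => /(_ isT) /nbhs_ballP[r /= r0 fr].
  exists (ball x (r / 2), [set s : R | s < r / 2]) => /=.
    split; first by apply: nbhsx_ballx; rewrite divr_gt0.
    by apply: nbhs_right_lt; rewrite divr_gt0.
  move=> [x' s] /= [xx' sr] y x'y.
  have h1 := fr _ (le_ball (_ : r / 2 <= r) xx').
  have h2 := fr _ (le_ball (_ : r / 2 + s <= r) (ball_triangle xx' x'y)).
  rewrite (le_lt_trans (ler_distD (f x) _ _)) // [e]splitr ltrD //.
    by rewrite distrC h1 //; lra.
  by rewrite h2 //; lra.
move=> H; near (0 : R)^'+ => r.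
exists r; first by near: r; exact: nbhs_right_gt.
by move=> x y Kx; apply: (near H r).
Unshelve. all: by end_near.
Qed.

End HeineCantor.

Lemma col_continuous (R : realType) (d : nat) (g : 'I_d -> R -> R) :
  (forall k, continuous (g k)) ->
  continuous (fun s : 'rV[R]_d => (\col_k g k (s 0 k) : 'cV[R]_d)).
Proof.
move=> cg s A [B nB BA].
have : nbhs (s : 'rV[R]_d) [set x : 'rV[R]_d | forall k, B k 0 (g k (x 0 k))].
  apply: (@filter_forall _ _ (fun k (x : 'rV[R]_d) => B k 0 (g k (x 0 k))) _
    (nbhs_filter (s : 'rV[R]_d))) => k.
  apply: (continuous_comp (f := fun x : 'rV[R]_d => x 0 k) (g := g k)) => //.
  - exact: coord_continuous.
  - exact: cg.
  - by have := nB k 0; rewrite mxE.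
by apply: filterS => x H; apply: BA => i j; rewrite mxE (ord1 j); exact: H.
Qed.

Section Approximation.
Context (R : realType) (d : nat).

(** Truncation to [[-c, c]], in a form that is visibly continuous. *)
Definition clip (c x : R) : R := (`|x + c| - `|x - c|) / 2.

Lemma clip_id c x : `|x| <= c -> clip c x = x.
Proof.
rewrite ler_norml /clip => /andP[h1 h2].
by rewrite (@ger0_norm _ (x + c)) 1?(@ler0_norm _ (x - c)); [field|lra|lra].
Qed.

Lemma clip_le c x : 0 <= c -> `|clip c x| <= c.
Proof.
move=> c0; rewrite /clip normrM [`|2^-1|]ger0_norm ?invr_ge0 //.
rewrite ler_pdivrMr //; apply: le_trans (ler_dist_dist _ _) _.
rewrite (_ : x + c - (x - c) = c * 2); last by ring.
by rewrite ger0_norm // mulr_ge0.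
Qed.

Lemma clip_continuous c : continuous (clip c).
Proof.
move=> x; apply: cvgM; last exact: cvg_cst.
apply: cvgB; apply: cvg_norm.
  exact: cvgD cvg_id (cvg_cst _).
exact: cvgB cvg_id (cvg_cst _).
Qed.

Let half_in : (2^-1 : R) \in `[- (pi / 2), pi / 2].
Proof. by have := @pihalf_ge1 R; rewrite in_itv /= => ?; apply/andP; split; lra. Qed.

Let s1 : R := sin 2^-1.

Lemma sin_half_bounds : 0 <= s1 < 1.
Proof.
have h := @pihalf_ge1 R; apply/andP; split.
  by apply: sin_ge0_pi; apply/andP; split; lra.
rewrite -(@sin_pihalf R) ltr_sin ?half_in //; first lra.
by rewrite in_itv /=; apply/andP; split; lra.
Qed.

(** A continuous left inverse of [sin] near 0, made total by clipping because
    [asin] is only continuous away from [-1] and [1]. *)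
Definition unsin (x : R) : R := asin (clip s1 x).

Lemma unsin_continuous : continuous unsin.
Proof.
move=> x; apply: continuous_comp; first exact: clip_continuous.
apply: continuous_asin; have /andP[h0 h1] := sin_half_bounds.
by have := clip_le x h0; rewrite ler_norml => /andP[? ?]; apply/andP; split; lra.
Qed.

Lemma unsinK x : `|x| <= 2^-1 -> unsin (sin x) = x.
Proof.
have h := @pihalf_ge1 R.
rewrite ler_norml => /andP[x1 x2]; rewrite /unsin clip_id.
  by rewrite sinK // in_itv /=; apply/andP; split; lra.
rewrite ler_norml -sinN !leNgt !ltr_sin -?leNgt ?x1 ?x2 //.
all: by rewrite in_itv /=; apply/andP; split; lra.
Qed.

Variables (f : 'cV[R]_d -> R) (M L : R).
Hypothesis cf : continuous f.
Hypothesis fM : forall v, `|f v| <= M.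
Hypothesis L0 : 0 < L.
Hypothesis d0 : (0 < d)%N.

Let dR0 : (d%:R : R) != 0. Proof. by rewrite pnatr_eq0 -lt0n. Qed.

Let sv (v : 'cV[R]_d) (k : 'I_d) : R := sin (v k 0 / (2 * L)).

Let svT k : trigpoly (fun v => sv v k).
Proof.
have := trigpoly_sin ((2 * L)^-1 *: delta_mx k 0 : 'cV[R]_d).
congr trigpoly; apply/funext => v; rewrite dotZl dotE (bigD1 k) //= big1 => [|j jk].
  by rewrite !mxE !eqxx mul1r addr0 mulrC.
by rewrite mxE (negbTE jk) mul0r.
Qed.

(** A coordinate drawn uniformly, with a random sign ([true] is the minus sign)
    whose mean is that coordinate of [sv v]; as a function of [v], the weight is
    a trigonometric polynomial. *)
Let q (v : 'cV[R]_d) (t : 'I_d * bool) : R :=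
  (1 + (-1) ^+ t.2 * sv v t.1) / (2 * d%:R).

Let qT t : trigpoly (fun v => q v t).
Proof.
have := trigpolyZ (2 * d%:R)^-1
  (trigpolyD (trigpoly_cst d 1) (trigpolyZ ((-1) ^+ t.2) (svT t.1))).
by congr trigpoly; apply/funext => v; rewrite mulrC.
Qed.

Let sv_le v k : -1 <= sv v k <= 1. Proof. by rewrite sin_geN1 sin_le1. Qed.

Let q_ge0 v t : 0 <= q v t.
Proof.
rewrite /q divr_ge0 //; have /andP[] := sv_le v t.1.
by case: t.2 => /=; rewrite ?expr1 ?expr0 => *; lra.
Qed.

Let sum_q v (g : 'I_d * bool -> R) : \sum_t q v t * g t =
  \sum_k ((1 - sv v k) * g (k, true) + (1 + sv v k) * g (k, false)) / (2 * d%:R).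
Proof.
rewrite (eq_bigr (fun t => q v (t.1, t.2) * g (t.1, t.2))); last by case.
rewrite -(pair_bigA _ (fun k b => q v (k, b) * g (k, b))) /=.
apply: eq_bigr => k _; rewrite big_bool /q /= expr1 expr0; field.
by rewrite dR0.
Qed.

Let q_sum1 v : \sum_t q v t = 1.
Proof.
under eq_bigr do rewrite -[q _ _]mulr1.
rewrite sum_q (eq_bigr (fun=> d%:R^-1)) => [|k _]; last by field; rewrite dR0.
by rewrite sumr_const card_ord -[LHS]mulr_natl divff.
Qed.

Variable m : nat.
Hypothesis m0 : (0 < m)%N.

Let mR0 : (m%:R : R) != 0. Proof. by rewrite pnatr_eq0 -lt0n. Qed.

(** The contribution of one draw, among [m], to the estimate of coordinate
    [k]; the factor [d] compensates for the choice of the coordinate. *)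
Let draw (k : 'I_d) (t : 'I_d * bool) : R :=
  d%:R / m%:R * (t.1 == k)%:R * (-1) ^+ t.2.

Let draw_mean v k : \sum_t q v t * draw k t = sv v k / m%:R.
Proof.
rewrite sum_q (bigD1 k) //= big1 => [|j jk]; last first.
  by rewrite /draw /= (negbTE jk) mulr0n ?expr2 !(mulr0, mul0r, addr0).
by rewrite /draw /= eqxx mulr1n expr1 expr0 addr0; field; rewrite dR0 mR0.
Qed.

Let draw_var v k :
  \sum_t q v t * (draw k t - sv v k / m%:R) ^+ 2 <= d%:R / m%:R ^+ 2.
Proof.
have -> : \sum_t q v t * (draw k t - sv v k / m%:R) ^+ 2 =
    \sum_t q v t * draw k t ^+ 2 - (sv v k / m%:R) ^+ 2.
  rewrite (eq_bigr (fun t => q v t * draw k t ^+ 2 -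
    2 * (sv v k / m%:R) * (q v t * draw k t)
    + (sv v k / m%:R) ^+ 2 * q v t)) => [|t _]; last by ring.
  by rewrite big_split sumrB /= -!mulr_sumr draw_mean q_sum1; ring.
rewrite lerBlDr; have -> : \sum_t q v t * draw k t ^+ 2 = d%:R / m%:R ^+ 2.
  rewrite sum_q (bigD1 k) //= big1 => [|j jk]; last first.
    by rewrite /draw /= (negbTE jk) mulr0n ?expr2 !(mulr0, mul0r, addr0).
  by rewrite /draw /= eqxx mulr1n expr1 expr0 addr0; field; rewrite dR0 mR0.
by rewrite lerDl sqr_ge0.
Qed.

Let est (x : {ffun 'I_m -> 'I_d * bool}) (k : 'I_d) : R := \sum_j draw k (x j).

Let est_var v k :
  avg (fun=> q v) (fun x => (sv v k - est x k) ^+ 2) <= d%:R / m%:R.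
Proof.
pose h (_ : nat) t := draw k t - sv v k / m%:R.
have -> : avg (fun=> q v) (fun x => (sv v k - est x k) ^+ 2) =
    avg (fun=> q v) (fun x : {ffun 'I_m -> _} => (0 + \sum_(i < m) h i (x i)) ^+ 2).
  apply: eq_bigr => x _; congr (_ * _).
  rewrite sumrB sumr_const card_ord add0r -[RHS]sqrrN opprB.
  by rewrite -[_ *+ m]mulr_natr divfK.
rewrite avg_sqr //; first last.
- move=> i; rewrite /h.
  rewrite (eq_bigr (fun t => q v t * draw k t - sv v k / m%:R * q v t)) => [|t _].
    by rewrite sumrB -mulr_sumr draw_mean q_sum1 mulr1 subrr.
  by ring.
rewrite expr0n /= add0r; apply: (@le_trans _ _ (\sum_(i < m) d%:R / m%:R ^+ 2)).
  by apply: ler_sum => i _; exact: draw_var.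
rewrite sumr_const card_ord -[leLHS]mulr_natr.
by rewrite (_ : _ * _ = d%:R / m%:R) //; field; rewrite mR0.
Qed.

Let arg (s : 'rV[R]_d) : 'cV[R]_d := \col_k (2 * L * unsin (s 0 k)).

Let arg_continuous : continuous (f \o arg).
Proof.
move=> s; apply: continuous_comp; last exact: cf.
exact: (@col_continuous R d (fun=> fun y => 2 * L * unsin y)
  (fun=> fun y => cvgM (cvg_cst _) (@unsin_continuous y)) s).
Qed.

(** The sum that defines the average is finite and its coefficients, values of
    [f], do not depend on [v]: the mean over [m] draws is therefore a
    trigonometric polynomial, with the same bound as [f]. *)
Let bern (v : 'cV[R]_d) : R := avg (fun=> q v) (fun x => f (arg (\row_(k < d) est x k))).

Let bernT : trigpoly bern.
Proof.
rewrite /bern /avg; apply: trigpoly_sum => x.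
have := trigpolyZ (f (arg (\row_(k < d) est x k)))
  (trigpoly_prod (index_enum _) (fun i : 'I_m => qT (x i))).
by congr trigpoly; apply/funext => v; rewrite mulrC.
Qed.

Let bern_le v : `|bern v| <= M.
Proof.
rewrite /bern; apply: le_trans (ler_norm_avg (fun=> q_ge0 v) _) _.
by rewrite -[leRHS](avg_cst (fun=> q_sum1 v) m) ler_avg.
Qed.

Let argK (v : 'cV[R]_d) : (forall k, `|v k 0| <= L) -> arg (\row_(k < d) sv v k) = v.
Proof.
move=> vL; apply/colP => k; rewrite !mxE unsinK.
  by field; rewrite gt_eqF.
have L2 : 0 <= (2 * L)^-1 by rewrite invr_ge0 mulr_ge0 // ltW.
rewrite normrM (ger0_norm L2).
rewrite ler_pdivrMr ?mulr_gt0 // mulrA mulVf // mul1r; exact: vL.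
Qed.

(** Chebyshev: by [est_var] the estimate is within [r] of [sv v] with large
    probability; otherwise the error is at most twice the bound. *)
Let bern_error (e r : R) : 0 < e -> 0 < r ->
  (forall s u : 'rV[R]_d, (forall k, -1 <= s 0 k <= 1) -> ball s r u ->
    `|f (arg s) - f (arg u)| < e) ->
  forall v : 'cV[R]_d, (forall k, `|v k 0| <= L) ->
  `|f v - bern v| <= e + 2 * M / r ^+ 2 * (d%:R ^+ 2 / m%:R).
Proof.
move=> e0 r0 Hr v vL; have r2 : 0 < r ^+ 2 by rewrite exprn_gt0.
have M0 : 0 <= M by apply: le_trans (fM 0).
have -> : f v - bern v =
    avg (fun=> q v) (fun x => f v + - 1 * f (arg (\row_(k < d) est x k))).
  by rewrite avgD avgZ (avg_cst (fun=> q_sum1 v)) mulN1r.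
apply: le_trans (ler_norm_avg (fun=> q_ge0 v) _) _.
apply: (@le_trans _ _ (avg (fun=> q v) (fun x => e + 2 * M / r ^+ 2 *
    \sum_k (sv v k - est x k) ^+ 2))).
  apply: ler_avg; first by move=> _; exact: q_ge0.
  move=> x; rewrite mulN1r.
  have S0 : 0 <= \sum_k (sv v k - est x k) ^+ 2 by apply: sumr_ge0 => k _; exact: sqr_ge0.
  (* Far from the target, the squared distance pays for the factor 2 M / r ^ 2. *)
  have [far|near] := pselect (exists k, r <= `|sv v k - est x k|).
    have [k rk] := far.
    apply: (@le_trans _ _ (2 * M)).
      by rewrite mulr_natl (le_trans (ler_normB _ _)) // mulr2n lerD.
    rewrite -[leLHS]add0r lerD ?(ltW e0) // -mulrA ler_peMr ?mulr_ge0 //.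
    rewrite mulrC ler_pdivlMr // mul1r (bigD1 k) //= -[leLHS]addr0 lerD //.
      by rewrite -[leRHS]real_normK ?num_real // lerXn2r ?nnegrE // (ltW r0).
    by apply: sumr_ge0 => j _; exact: sqr_ge0.
  apply: (@le_trans _ _ e); last first.
    by rewrite lerDl mulr_ge0 // divr_ge0 ?(ltW r2) // mulr_ge0.
  rewrite -{1}(argK vL) ltW //; apply: Hr => [k|]; first by rewrite mxE.
  split => // i k; rewrite !mxE /ball /=.
  by rewrite ltNge; apply/negP => h; apply: near; exists k.
rewrite avgD (avg_cst (fun=> q_sum1 v)) avgZ avg_sum lerD2l ler_wpM2l //.
  by rewrite divr_ge0 ?(ltW r2) // mulr_ge0.
apply: (@le_trans _ _ (\sum_(k < d) d%:R / m%:R)).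
  by apply: ler_sum => k _; exact: est_var.
by rewrite sumr_const card_ord -[leLHS]mulr_natl expr2 mulrA.
Qed.

Lemma bernstein_trig (e r : R) : 0 < e -> 0 < r ->
  (forall s u : 'rV[R]_d, (forall k, -1 <= s 0 k <= 1) -> ball s r u ->
    `|f (arg s) - f (arg u)| < e) ->
  exists B, [/\ trigpoly B, forall v, `|B v| <= M &
    forall v : 'cV[R]_d, (forall k, `|v k 0| <= L) ->
      `|f v - B v| <= e + 2 * M / r ^+ 2 * (d%:R ^+ 2 / m%:R)].
Proof. by move=> e0 r0 H; exists bern; split => //; exact: bern_error. Qed.

Lemma arg_uniform (e : R) : 0 < e -> exists2 r, 0 < r &
  forall s u : 'rV[R]_d, (forall k, -1 <= s 0 k <= 1) -> ball s r u ->
    `|f (arg s) - f (arg u)| < e.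
Proof.
move=> e0; have cK := rV_compact (fun _ : 'I_d => @segment_compact R (-1) 1).
have [r r0 H] := compact_uniform_continuous cK arg_continuous e0.
by exists r => // s u s1'; apply: H => k /=; rewrite in_itv /=; exact: s1'.
Qed.

End Approximation.

(** The bound on [B] holds outside the box too, where [B] does not approximate
    [f]: this is what lets tightness alone control the mass escaping the box. *)
Lemma trigpoly_approx (R : realType) (d : nat) (f : 'cV[R]_d -> R) (M L e : R) :
  continuous f -> (forall v, `|f v| <= M) -> 0 < e ->
  exists B, [/\ trigpoly B, forall v, `|B v| <= M &
    forall v : 'cV[R]_d, (forall k, `|v k 0| <= L) -> `|f v - B v| <= e].
Proof.
move=> cf fM e0; have [d0|d0] := posnP d.
  exists (fun=> f 0); split => // [|v _]; first exact: trigpoly_cst.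
  suff -> : v = 0 by rewrite subrr normr0 ltW.
  by apply/colP => k; have := ltn_ord k; rewrite {2}d0 ltn0.
wlog L0 : L / 0 < L.
  have L1 : 0 < Num.max L 1 by rewrite lt_max ltr01 orbT.
  move=> /(_ _ L1)[B [TB BM HB]]; exists B; split => // v vL; apply: HB => k.
  by rewrite (le_trans (vL k)) // le_max lexx.
have e2 : 0 < e / 2 by rewrite divr_gt0.
have [r r0 Hr] := arg_uniform L cf e2.
pose C := 2 * M / r ^+ 2 * d%:R ^+ 2.
have M0 : 0 <= M by apply: le_trans (fM 0).
have C0 : 0 <= C by rewrite mulr_ge0 ?sqr_ge0 // divr_ge0 ?sqr_ge0 // mulr_ge0.
pose m := (Num.bound (C / (e / 2))).+1.
have [B [TB BM HB]] := bernstein_trig fM L0 d0 (ltn0Sn _ : (0 < m)%N) e2 r0 Hr.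
exists B; split => // v vL; apply: le_trans (HB v vL) _.
rewrite {2}[e]splitr lerD2l mulrA -/C ler_pdivrMr // mulrC -ler_pdivrMr //.
apply/ltW/(lt_trans (archi_boundP _)); first by rewrite divr_ge0 // ltW.
by rewrite ltr_nat.
Qed.

(** * Integrals of bounded functions *)

Section BoundedIntegral.
Context (R : realType) (dT : measure_display) (T : measurableType dT).
Variable m : {measure set T -> \bar R}.
Hypothesis m1 : m setT = 1%E.
Implicit Types (f g : T -> R).

Lemma prob_bounded_integrable f M : measurable_fun setT f ->
  (forall x, `|f x| <= M) -> m.-integrable setT (EFin \o f).
Proof.
move=> mf fM; apply: measurable_bounded_integrable => //.
  by rewrite m1 ltry.
exists M; split; first exact: num_real.
by move=> y My x _; exact: le_trans (fM x) (ltW My).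
Qed.

Lemma total1_fin_num A : measurable A -> m A \is a fin_num.
Proof.
move=> mA; rewrite ge0_fin_numE // (@le_lt_trans _ _ (m setT)) ?m1 ?ltry //.
by rewrite -m1; apply: le_measure; rewrite ?inE.
Qed.

Lemma EFin_Rintegral f M : measurable_fun setT f -> (forall x, `|f x| <= M) ->
  (\int[m]_x (f x)%:E)%E = (\int[m]_x f x)%:E.
Proof.
move=> mf fM; rewrite fineK //; apply: integrable_fin_num => //.
exact: prob_bounded_integrable fM.
Qed.

Lemma Rintegral_dist_le f g M e E : measurable_fun setT f -> measurable_fun setT g ->
  (forall x, `|f x| <= M) -> (forall x, `|g x| <= M) -> measurable E -> 0 <= e ->
  (forall x, E x -> `|f x - g x| <= e) ->
  `|\int[m]_x f x - \int[m]_x g x| <= e + 2 * M * fine (m (~` E)).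
Proof.
move=> mf mg fM gM mE e0 fg.
have fi := prob_bounded_integrable mf fM; have gi := prob_bounded_integrable mg gM.
have fgi : m.-integrable setT (EFin \o (fun x => f x - g x)).
  apply: (prob_bounded_integrable (M := M + M)); first exact: measurable_funB.
  by move=> x; rewrite (le_trans (ler_normB _ _)) // lerD.
have mE' : measurable (~` E) by exact: measurableC.
rewrite -RintegralB //.
apply: le_trans (le_normr_Rintegral measurableT fgi) _.
have b2 x : `|2 * M * \1_(~` E) x| <= `|2 * M|.
  rewrite normrM -[leRHS]mulr1 ler_wpM2l // indicE ger0_norm ?ler0n //.
  by case: (_ \in _).
have m2 : measurable_fun setT (fun x => 2 * M * \1_(~` E) x : R).
  by apply: measurable_funM => //; exact: measurable_indic.
have i2 := prob_bounded_integrable m2 b2.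
have i1 : m.-integrable setT (EFin \o (fun=> e)).
  exact: (prob_bounded_integrable (M := `|e|)).
have ii : m.-integrable setT (EFin \o (\1_(~` E) : T -> R)).
  apply: (prob_bounded_integrable (M := 1)); first exact: measurable_indic.
  by move=> x; rewrite indicE ger0_norm ?ler0n //; case: (_ \in _).
have -> : e + 2 * M * fine (m (~` E)) = \int[m]_x (e + 2 * M * \1_(~` E) x).
  rewrite RintegralD // RintegralZl // Rintegral_cst // m1 mulr1.
  by rewrite /Rintegral integral_indic // setIT.
apply: le_Rintegral => //.
- apply: (prob_bounded_integrable (M := M + M)).
    by apply: measurableT_comp => //; exact: measurable_funB.
  by move=> x; rewrite normr_id (le_trans (ler_normB _ _)) // lerD.
- apply: (prob_bounded_integrable (M := `|e| + `|2 * M|)).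
    by apply: measurable_funD.
  by move=> x; rewrite (le_trans (ler_normD _ _)) // lerD.
- move=> x _; rewrite indicE; have [Ex|nEx] := pselect (E x).
    by rewrite memNset ?mulr0 ?addr0 ?fg // => /(_ Ex).
  rewrite mem_set // mulr1 (le_trans (ler_normB _ _)) // mulr_natl mulr2n.
  by rewrite -[leLHS]add0r lerD // lerD.
Qed.

End BoundedIntegral.

(** * Borel sets of column vectors *)

Lemma measurable_forall dT (T : measurableType dT) (I : finType) (A : I -> set T) :
  (forall i, measurable (A i)) -> measurable [set x | forall i, A i x].
Proof.
move=> mA; rewrite (_ : mkset _ = \bigcap_(i in setT) A i); last first.
  by apply/seteqP; split => [x Ax i _|x Ax i]; exact: Ax.
by apply: fin_bigcap_measurable => // i _; exact: mA.
Qed.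

Section BorelVectors.
Context (R : realType) (d : nat).

Lemma continuous_measurable_cV (f : 'cV[R]_d -> R) : continuous f ->
  measurable_fun [set: borel_cV R d] (f : borel_cV R d -> R).
Proof.
move=> /continuousP cf; apply: (measurability _ (RGenOpens.measurableE R)).
move=> _ [_ [a [b ->] <-]]; rewrite setTI; apply: sub_sigma_algebra.
exact/cf/interval_open.
Qed.

Definition box (L : R) : set (borel_cV R d) := [set v | forall k, `|v k 0| <= L].

Lemma coord_measurable k :
  measurable_fun [set: borel_cV R d] (fun v : borel_cV R d => v k 0 : R).
Proof. by apply: continuous_measurable_cV; exact: coord_continuous. Qed.

Lemma box_measurable L : measurable (box L).
Proof.
apply: measurable_forall => k.
have := @coord_measurable k measurableT _ (measurable_itv `[- L, L]).
by congr measurable; apply/seteqP; split => v /=; rewrite in_itv /= ler_norml; [case|split].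
Qed.

(** The complements of the boxes decrease to the empty set. *)
Lemma box_tight (m : {measure set (borel_cV R d) -> \bar R}) (e : R) :
  m setT = 1%E -> 0 < e -> exists L, fine (m (~` box L)) <= e.
Proof.
move=> m1 e0; pose F n := ~` box n%:R.
have mF n : measurable (F n) by apply: measurableC; exact: box_measurable.
have F0 : \bigcap_n F n = set0.
  rewrite -subset0 => v /= Fv.
  pose n := \max_(k < d) (Num.bound `|v k 0%R|%R).
  apply: (Fv n I) => k; apply/ltW/(lt_le_trans (archi_boundP (normr_ge0 _))).
  by rewrite ler_nat (@leq_bigmax _ (fun k : 'I_d => Num.bound `|v k 0%R|%R)).
have : m \o F @ \oo --> m (\bigcap_n F n).
  apply: nonincreasing_cvg_mu => //.
  - by rewrite ltey_eq total1_fin_num.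
  - by rewrite F0.
  - move=> i j ij; apply/subsetPset => v nv vi; apply: nv => k.
    by rewrite (le_trans (vi k)) // ler_nat.
rewrite F0 measure0 => /fine_cvg /cvgrPdist_le /(_ e e0) [n _ /(_ n (leqnn n))] /=.
rewrite sub0r normrN ger0_norm ?fine_ge0 // => Fe.
by exists n%:R.
Qed.

End BorelVectors.

(** * Weak convergence from characteristic functions *)

Section CharacteristicFunctions.
Context (R : realType) (d : nat).
Variables (m_ : nat -> {measure set (borel_cV R d) -> \bar R}).
Variable m : {measure set (borel_cV R d) -> \bar R}.
Hypothesis m1_ : forall n, m_ n setT = 1%E.
Hypothesis m1 : m setT = 1%E.
Hypothesis char_cvg : forall t th,
  \int[m_ n]_v cos (dot t v + th) @[n --> \oo] --> \int[m]_v cos (dot t v + th).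
Hypothesis tight : forall e, 0 < e ->
  exists L, forall n, fine (m_ n (~` box L)) <= e.

Lemma trigpoly_cvg B : trigpoly B ->
  \int[m_ n]_v B v @[n --> \oo] --> \int[m]_v B v.
Proof.
have TI (mu : {measure set (borel_cV R d) -> \bar R}) f : mu setT = 1%E -> trigpoly f ->
    mu.-integrable setT (EFin \o f).
  move=> mu1 tf; have [M fM] := trigpoly_bounded tf.
  apply: (prob_bounded_integrable mu1 _ fM).
  by apply: continuous_measurable_cV; exact: trigpoly_continuous.
elim=> {B} [t th|f g tf cf tg cg|c f tf cf]; first exact: char_cvg.
- rewrite RintegralD //; [|exact: TI|exact: TI].
  rewrite (_ : (fun n => _) = (fun n => \int[m_ n]_v f v + \int[m_ n]_v g v)).
    exact: cvgD.
  by apply/funext => n; rewrite RintegralD //; [exact: TI|exact: TI].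
- rewrite RintegralZl //; last exact: TI.
  rewrite (_ : (fun n => _) = (fun n => c * \int[m_ n]_v f v)).
    exact: cvgM (cvg_cst _) cf.
  by apply/funext => n; rewrite RintegralZl //; exact: TI.
Qed.

Lemma box_mono (L L' : R) : L <= L' -> ~` @box R d L' `<=` ~` @box R d L.
Proof.
by move=> LL v nv vL; apply: nv => k; exact: le_trans (vL k) LL.
Qed.

(** Replace the test function by a trigonometric polynomial close to it on a box
    that carries almost all the mass of every [m_ n] and of [m]. *)
Lemma char_weak_cvg : weak_cvg m_ m.
Proof.
move=> f cf [M fM].
have mf := continuous_measurable_cV cf.
rewrite (EFin_Rintegral m1 mf fM).
under eq_fun do rewrite (EFin_Rintegral (m1_ _) mf fM).
apply/fine_cvgP; split; first exact: nearW.
suff : \int[m_ n]_v f v @[n --> \oo] --> \int[m]_v f v by [].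
apply/cvgrPdist_le => e e0.
have M0 : 0 <= M by exact: le_trans (fM 0).
(* Each of the two measures contributes e / 8 on the box and at most 2 M e'
   outside it; M + 1 avoids dividing by 0. *)
pose e' := e / (8 * (M + 1)).
have e'0 : 0 < e' by rewrite divr_gt0 // mulr_gt0 // ltr_wpDl.
have [L1 t1] := tight e'0; have [L2 t2] := box_tight m1 e'0.
pose L := Num.max L1 L2.
have e8 : 0 < e / 8 by rewrite divr_gt0.
have [B [TB BM HB]] := trigpoly_approx L cf fM e8.
have mB := continuous_measurable_cV (trigpoly_continuous TB).
have err (mu : {measure set (borel_cV R d) -> \bar R}) L' : mu setT = 1%E -> L' <= L ->
    fine (mu (~` box L')) <= e' -> `|\int[mu]_v f v - \int[mu]_v B v| <= 3 * (e / 8).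
  move=> mu1 LL' muL.
  have h := Rintegral_dist_le mu1 mf mB fM BM (@box_measurable R d L) (ltW e8) HB.
  apply: le_trans h _.
  have : fine (mu (~` box L)) <= e'.
    have mC (K : R) : measurable (~` @box R d K).
      by apply: measurableC; exact: box_measurable.
    apply: le_trans muL; apply: fine_le; [exact: total1_fin_num..|].
    by apply: le_measure; rewrite ?inE //; exact: box_mono.
  have : M * e' <= e / 8.
    rewrite /e' mulrA ler_pdivrMr ?mulr_gt0 ?ltr_wpDl //.
    rewrite (_ : e / 8 * (8 * (M + 1)) = M * e + e); [lra|by field].
  move=> h1 h2; have := ler_wpM2l M0 h2; lra.
have /cvgrPdist_le /(_ (e / 8) e8) := trigpoly_cvg TB.
apply: filterS => n Hn.
have h1 := err _ _ (m1_ n) (ltac:(by rewrite le_max lexx) : L1 <= L) (t1 n).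
have h2 := err _ _ m1 (ltac:(by rewrite le_max lexx orbT) : L2 <= L) t2.
move: h1 h2 Hn; rewrite !ler_norml => /andP[? ?] /andP[? ?] /andP[? ?].
by apply/andP; split; lra.
Qed.

End CharacteristicFunctions.

(** * The Gaussian characteristic function *)

Section IntegralDerivative.
Context (R : realType).
Notation leb := (@lebesgue_measure R).

(** The fundamental theorem of calculus on [[-n, n]], then dominated
    convergence. *)
Lemma integral_derivative_eq0 (H h : R -> R) :
  (forall x, is_derive x (1 : R) H (h x)) -> continuous h ->
  leb.-integrable setT (EFin \o h) ->
  H n%:R @[n --> \oo] --> 0 -> H (- n%:R) @[n --> \oo] --> 0 ->
  \int[leb]_x h x = 0.
Proof.
move=> dH ch ih Hp Hm.
have cH x : {for x, continuous H}.
  by apply: differentiable_continuous; apply/derivable1_diffP; exact: ex_derive.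
have mh := continuous_measurable_fun ch.
pose hn n := (EFin \o h) \_ `[- n%:R, n%:R]%classic : R -> \bar R.
have mhn n : measurable_fun setT (hn n).
  apply/(measurable_restrictT _ _).1 => //; apply: measurable_funTS.
  exact: measurable_int ih.
have cvg_pt x : hn n x @[n --> \oo] --> (EFin \o h) x.
  apply: cvg_near_cst.
  exists (Num.bound `|x|) => // n /= xn.
  rewrite /hn patchE mem_set //= in_itv /= -ler_norml.
  by apply/ltW/(lt_le_trans (archi_boundP (normr_ge0 _))); rewrite ler_nat.
have bnd x n : (`|hn n x| <= (abse \o (EFin \o h)) x)%E.
  by rewrite /hn patchE; case: ifP => // _; rewrite abse0 abse_ge0.
have ae1 : {ae leb, forall x, setT x -> hn ^~ x @ \oo --> (EFin \o h) x}.
  by apply: aeW => x _; exact: cvg_pt.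
have ae2 : {ae leb, forall x n, setT x -> (`|hn n x| <= (abse \o (EFin \o h)) x)%E}.
  by apply: aeW => x n _; exact: bnd.
have [_ _ cvgI] := @dominated_convergence _ _ _ leb _ measurableT _ _ _ mhn
  (measurable_int _ ih) ae1 (integrable_abse ih) ae2.
have E n : (\int[leb]_x hn n.+1 x = (H n.+1%:R - H (- n.+1%:R))%:E)%E.
  rewrite /hn -integral_mkcond (@continuous_FTC2 R h H).
  - by [].
  - have h0 : (0 : R) < n.+1%:R by rewrite ltr0Sn.
    lra.
  - exact: continuous_subspaceT.
  - split.
    + by move=> x _; exact: ex_derive.
    + by apply: cvg_at_right_filter; exact: cH.
    + by apply: cvg_at_left_filter; exact: cH.
  - move=> x _; rewrite derive1E; exact: derive_val.
rewrite /Rintegral.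
have I0 : (fun n => \int[leb]_x hn n x)%E @ \oo --> 0%E.
  rewrite -cvg_shiftS /=.
  rewrite (_ : (fun n => _) = (fun n => (H n.+1%:R - H (- n.+1%:R))%:E)); last first.
    by apply/funext => n; rewrite -E.
  apply/fine_cvgP; split; first exact: nearW.
  suff : H n.+1%:R - H (- n.+1%:R) @[n --> \oo] --> 0 by [].
  rewrite -[X in _ --> X]subr0; apply: cvgB.
    by move: Hp; rewrite -cvg_shiftS.
  by move: Hm; rewrite -cvg_shiftS.
by have /= -> := cvg_unique (@ereal_hausdorff R) cvgI I0.
Qed.

End IntegralDerivative.

Section GaussianCharacteristic.
Context (R : realType) (s : R).
Hypothesis s0 : 0 < s.
Notation leb := (@lebesgue_measure R).

Let sn0 : s != 0. Proof. by rewrite gt_eqF. Qed.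
Let w := normal_pdf 0 s.

Let wE x : w x = normal_peak s * expR (- (x ^+ 2 / (s ^+ 2 *+ 2))).
Proof. by rewrite /w normal_pdfE // /normal_fun subr0 mulNr. Qed.

Let w_ge0 x : 0 <= w x. Proof. exact: normal_pdf_ge0. Qed.

Let dw x : is_derive x (1 : R) w (- (x / s ^+ 2) * w x).
Proof.
rewrite (_ : w = fun x => normal_peak s * expR (- (x ^+ 2 / (s ^+ 2 *+ 2)))).
  by apply: is_derive_eq; rewrite /GRing.scale /=; field.
by apply/funext => y; exact: wE.
Qed.

Let cw : continuous w. Proof. exact: continuous_normal_pdf. Qed.

Let C := s * normal_peak s / normal_peak (2 * s).

Let C_ge0 : 0 <= C.
Proof. by rewrite divr_ge0 ?normal_peak_ge0 // mulr_ge0 ?normal_peak_ge0 // ltW. Qed.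

(** A wider Gaussian absorbs the linear factor. *)
Let xw_le x : `|x| * w x <= C * normal_pdf 0 (2 * s) x.
Proof.
have s20 : 2 * s != 0 by rewrite mulf_neq0.
have pk : normal_peak (2 * s) != 0 by rewrite gt_eqF // normal_peak_gt0.
rewrite wE normal_pdfE // /normal_fun subr0 /C.
rewrite (_ : _ / _ * _ = s * normal_peak s * expR (- x ^+ 2 / ((2 * s) ^+ 2 *+ 2))); last first.
  by rewrite mulrA divfK.
set A := - _; set B := - _ / _.
rewrite (_ : `|x| * _ = normal_peak s * (`|x| * expR A)); last by ring.
rewrite (_ : s * _ * _ = normal_peak s * (s * expR B)); last by ring.
rewrite ler_wpM2l ?normal_peak_ge0 //.
pose y := `|x| / s; have xE : `|x| = y * s by rewrite divfK.
rewrite {1}xE [y * s]mulrC -mulrA ler_wpM2l ?(ltW s0) //.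
(* The gap 3 y^2 / 8 between the exponents beats y, since y <= 1 + 3 y^2 / 8. *)
have BA : B = 3 / 8 * y ^+ 2 + A.
  by rewrite /B /A -(real_normK (num_real x)) xE; field.
rewrite BA expRD ler_wpM2r ?expR_ge0 //.
apply: le_trans (expR_ge1Dx _).
by have := sqr_ge0 (y - 2); have := sqr_ge0 y; rewrite !expr2; nra.
Qed.

Let int_w : leb.-integrable setT (EFin \o w).
Proof. exact: integrable_normal_pdf. Qed.

Let int_xw : leb.-integrable setT (EFin \o (fun x => `|x| * w x)).
Proof.
apply: (@le_integrable _ _ _ leb _ measurableT _
  (fun x => (C * normal_pdf 0 (2 * s) x)%:E)).
- apply/measurable_EFinP; apply: continuous_measurable_fun => x.
  exact: cvgM (@norm_continuous _ _ x) (@cw x).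
- move=> x _ /=; rewrite lee_fin [leLHS]ger0_norm ?mulr_ge0 //.
  by rewrite (le_trans (xw_le x)) // ler_norm.
exact: (integrableZl measurableT C (integrable_normal_pdf 0 (2 * s))).
Qed.

Let w_tail n : `|w n.+1%:R| <= C * normal_peak (2 * s) * n.+1%:R^-1.
Proof.
rewrite ger0_norm // ler_pdivlMr ?ltr0Sn // mulrC.
rewrite -{1}[n.+1%:R]ger0_norm //; apply: le_trans (xw_le _) _.
by rewrite ler_wpM2l // normal_pdf_ub // mulf_neq0.
Qed.

Let w_even x : w (- x) = w x. Proof. by rewrite !wE sqrrN. Qed.

Let w_cvg0 : w n%:R @[n --> \oo] --> 0.
Proof.
rewrite -cvg_shiftS; apply: norm_cvg0.
have Cn : (fun n => C * normal_peak (2 * s) * n.+1%:R^-1) @ \oo --> 0.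
  rewrite -[X in _ --> X](mulr0 (C * normal_peak (2 * s))).
  exact: cvgM (cvg_cst _) cvg_harmonic.
apply: (@squeeze_cvgr _ _ _ _ (cst 0) _ _ _ _ _ Cn); last exact: cvg_cst.
by apply: nearW => n; rewrite normr_ge0 w_tail.
Qed.

Variable th : R.

Let psi a := \int[leb]_x (cos (a * x + th) * w x).

Let dom (f : R -> R) (g : R -> R) : measurable_fun setT f ->
  (forall x, `|f x| <= g x) -> leb.-integrable setT (EFin \o g) ->
  leb.-integrable setT (EFin \o f).
Proof.
move=> mf fg ig; apply: (@le_integrable _ _ _ leb _ measurableT _ (EFin \o g)) => //.
  exact/measurable_EFinP.
by move=> x _ /=; rewrite lee_fin (le_trans (fg x)) // ler_norm.
Qed.

Let cont_lin a : continuous (fun x : R => a * x + th).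
Proof. by move=> x; apply: cvgD (cvg_cst _); apply: cvgM (cvg_cst _) cvg_id. Qed.

Let cont_cos a : continuous (fun x : R => cos (a * x + th)).
Proof. by move=> x; apply: continuous_comp; [exact: cont_lin|exact: continuous_cos]. Qed.

Let cont_sin a : continuous (fun x : R => sin (a * x + th)).
Proof. by move=> x; apply: continuous_comp; [exact: cont_lin|exact: continuous_sin]. Qed.

Let cos_norm (y : R) : `|cos y| <= 1. Proof. by rewrite ler_norml cos_geN1 cos_le1. Qed.
Let sin_norm (y : R) : `|sin y| <= 1. Proof. by rewrite ler_norml sin_geN1 sin_le1. Qed.

Let cw_int a : leb.-integrable setT (EFin \o (fun x => cos (a * x + th) * w x)).
Proof.
apply: dom int_w.
  by apply: continuous_measurable_fun => x; exact: cvgM (@cont_cos a x) (@cw x).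
by move=> x; rewrite normrM (ger0_norm (w_ge0 x)) -[leRHS]mul1r ler_wpM2r.
Qed.

Let sw_int a : leb.-integrable setT (EFin \o (fun x => x * sin (a * x + th) * w x)).
Proof.
apply: dom int_xw.
  apply: continuous_measurable_fun => x.
  exact: cvgM (cvgM cvg_id (@cont_sin a x)) (@cw x).
move=> x; rewrite !normrM (ger0_norm (w_ge0 x)) ler_wpM2r //.
by rewrite -[leRHS]mulr1 ler_wpM2l.
Qed.

(** The derivative of [w] is [- (x / s ^+ 2) * w x], so [x * w x] is a derivative
    up to a factor, and the boundary terms vanish at infinity. *)
Let by_parts a :
  \int[leb]_x (x * sin (a * x + th) * w x) = s ^+ 2 * a * psi a.
Proof.
pose H x := sin (a * x + th) * w x.
pose h x := a * (cos (a * x + th) * w x) + (- s ^- 2) * (x * sin (a * x + th) * w x).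
have H0 (e : nat -> R) : (forall n, w (e n) = w n%:R) -> H (e n) @[n --> \oo] --> 0.
  move=> we; apply: norm_cvg0.
  have Wn : (fun n => `|w n%:R|) @ \oo --> 0.
    by rewrite -[X in _ --> X](normr0 R); apply: cvg_norm.
  apply: (@squeeze_cvgr _ _ _ _ (cst 0) _ _ _ _ _ Wn); last exact: cvg_cst.
  by apply: nearW => n; rewrite normr_ge0 /H normrM we -[leRHS]mul1r ler_wpM2r.
have : \int[leb]_x h x = 0.
  apply: (@integral_derivative_eq0 _ H h).
  - move=> x; rewrite /H.
    have ds : is_derive x (1 : R) (fun y => sin (a * y + th)) (cos (a * x + th) * a).
      have dl : is_derive x (1 : R) (fun y => a * y + th) a.
        by apply: is_derive_eq; rewrite /GRing.scale /=; ring.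
      exact: (@is_derive1_comp R sin (fun y => a * y + th) x _ _ (is_derive_sin _) dl).
    by apply: (is_derive_eq (is_deriveM ds (dw x))); rewrite /GRing.scale /h /=; field.
  - move=> x; apply: cvgD; apply: cvgM (cvg_cst _) _.
      exact: cvgM (@cont_cos a x) (@cw x).
    exact: cvgM (cvgM cvg_id (@cont_sin a x)) (@cw x).
  - exact: (integrableD measurableT (integrableZl measurableT a (cw_int a))
      (integrableZl measurableT (- s ^- 2) (sw_int a))).
  - exact: H0.
  - by apply: (H0 (fun n => - n%:R)) => n; rewrite w_even.
rewrite RintegralD //; last 2 first.
- exact: (integrableZl measurableT a (cw_int a)).
- exact: (integrableZl measurableT (- s ^- 2) (sw_int a)).
rewrite (RintegralZl a measurableT (cw_int a)).
rewrite (RintegralZl (- s ^- 2) measurableT (sw_int a)).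
rewrite -/(psi a); set I := Rintegral _ _ _ => /eqP.
rewrite addr_eq0 mulNr opprK => /eqP E.
by rewrite -mulrA E mulrA mulfV ?mul1r // expf_neq0.
Qed.

(** Differentiation under the integral sign, dominated by [`|x| * w x]; the
    result is expressed through [psi] by the integration by parts above. *)
Let dpsi a : is_derive a (1 : R) psi (- (s ^+ 2 * a * psi a)).
Proof.
pose f a x := cos (a * x + th) * w x.
have df b x : is_derive b (1 : R) (f ^~ x) (- (x * sin (b * x + th) * w x)).
  have dl : is_derive b (1 : R) (fun y => y * x + th) x.
    by apply: is_derive_eq; rewrite /GRing.scale /=; ring.
  have dc : is_derive b (1 : R) (fun y => cos (y * x + th)) (- sin (b * x + th) * x).
    exact: (@is_derive1_comp R cos (fun y => y * x + th) b _ _ (is_derive_cos _) dl).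
  by apply: (is_derive_eq (is_deriveM dc (is_derive_cst (w x) b 1)));
    rewrite /GRing.scale /=; ring.
have pE b x : partial1of2 f b x = - (x * sin (b * x + th) * w x).
  by rewrite /partial1of2 derive1E; exact: derive_val.
have Ia : `]a - 1, a + 1[%classic a by rewrite /= in_itv /=; apply/andP; split; lra.
have If b : `]a - 1, a + 1[%classic b -> leb.-integrable setT (EFin \o f b).
  by move=> _; exact: cw_int.
have Df b x : `]a - 1, a + 1[%classic b -> setT x -> derivable (f ^~ x) b 1.
  by move=> _ _; exact: ex_derive.
have Gf b x : `]a - 1, a + 1[%classic b -> setT x -> `|partial1of2 f b x| <= `|x| * w x.
  move=> _ _; rewrite pE normrN !normrM (ger0_norm (w_ge0 x)) ler_wpM2r //.
  by rewrite -[leRHS]mulr1 ler_wpM2l.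
have G0 x : 0 <= `|x| * w x by rewrite mulr_ge0.
apply: DeriveDef.
  exact: (derivable_under_integral measurableT Ia If Df G0 int_xw Gf).
rewrite -derive1E (differentiation_under_integral measurableT Ia If Df G0 int_xw Gf).
rewrite (@eq_Rintegral _ _ _ leb setT (fun x => -1 * (x * sin (a * x + th) * w x))); last first.
  by move=> x _; rewrite pE mulN1r.
by rewrite RintegralZl ?by_parts ?mulN1r //; exact: sw_int.
Qed.

(** By the differential equation satisfied by [psi], the product of [psi a] and
    [expR (a ^+ 2 * s ^+ 2 / 2)] does not depend on [a]. *)
Lemma integral_cos_normal_pdf a :
  \int[leb]_x (cos (a * x + th) * normal_pdf 0 s x) =
  cos th * expR (- (a ^+ 2 * s ^+ 2 / 2)).
Proof.
pose F a := psi a * expR (a ^+ 2 * s ^+ 2 / 2).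
have dF b : is_derive b (1 : R) F 0.
  have dE : is_derive b (1 : R) (fun y => expR (y ^+ 2 * s ^+ 2 / 2))
      (b * s ^+ 2 * expR (b ^+ 2 * s ^+ 2 / 2)).
    by apply: is_derive_eq; rewrite /GRing.scale /=; field.
  by apply: (is_derive_eq (is_deriveM (dpsi b) dE)); rewrite /GRing.scale /=; ring.
have := @is_derive_0_is_cst R F a 0 dF.
rewrite {2}/F expr0n /= !mul0r expR0 mulr1.
have -> : psi 0 = cos th.
  rewrite /psi (@eq_Rintegral _ _ _ leb setT (fun x => cos th * w x)); last first.
    by move=> x _; rewrite mul0r add0r.
  by rewrite RintegralZl // /Rintegral integral_normal_pdf mulr1.
by move=> <-; rewrite /F -[RHS]mulrA -expRD subrr expR0 mulr1.
Qed.

End GaussianCharacteristic.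

(** The change of variables is available for the Radon-Nikodym derivative, which
    agrees almost everywhere with the density by uniqueness. *)
Lemma integral_normal_prob (R : realType) (m s : R) (f : R -> R) :
  (normal_prob m s).-integrable setT (EFin \o f) ->
  (\int[normal_prob m s]_x (f x)%:E =
   \int[@lebesgue_measure R]_x (f x * normal_pdf m s x)%:E)%E.
Proof.
move=> intf; set nu := normal_prob m s; pose leb := @lebesgue_measure R.
have dom := @normal_prob_dominates R m s.
have mf := measurable_int _ intf.
rewrite -(Radon_Nikodym_change_of_variables dom measurableT intf).
have mpdf : measurable_fun setT (EFin \o normal_pdf m s).
  by apply/measurable_EFinP; exact: measurable_normal_pdf.
apply: ae_eq_integral => //.
- apply: emeasurable_funM => //.
- apply/measurable_EFinP; apply: measurable_funM; first exact/measurable_EFinP.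
  exact: measurable_normal_pdf.
have : ae_eq leb setT (Radon_Nikodym (charge_of_finite_measure nu) leb) (EFin \o normal_pdf m s).
  apply: integral_ae_eq => //; first exact: Radon_Nikodym_integrable.
  by move=> E _ mE; rewrite -Radon_Nikodym_integral.
by apply: filterS => x /= H _; rewrite H.
Qed.

(** Both cases of [normal_law] are covered by one formula, so that degenerate
    covariances need no separate treatment later. *)
Lemma normal_law_char (R : realType) (v : R) : 0 <= v ->
  exists2 nu : probability (measurableTypeR R) R,
    forall A, nu A = normal_law 0 v A &
    forall a th, \int[nu]_x cos (a * x + th) = cos th * expR (- (a ^+ 2 * v / 2)).
Proof.
move=> v0; have mc a th : measurable_fun [set: R] (fun x : R => cos (a * x + th)).
  apply: continuous_measurable_fun => x; apply: continuous_comp.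
    by apply: cvgD (cvg_cst _); apply: cvgM (cvg_cst _) cvg_id.
  exact: continuous_cos.
rewrite /normal_law; case: eqP => [->|/eqP vn0].
  exists (\d_(0 : measurableTypeR R)); first by [].
  move=> a th; rewrite /Rintegral integral_dirac // ?diracT ?mul1e /=.
    by rewrite mulr0 add0r mulr0 mul0r oppr0 expR0 mulr1.
  by apply/measurable_EFinP; exact: mc.
have s0 : 0 < Num.sqrt v by rewrite sqrtr_gt0 lt_neqAle eq_sym vn0.
exists [the probability _ R of normal_prob 0 (Num.sqrt v)]; first by [].
move=> a th; rewrite /Rintegral integral_normal_prob; last first.
  apply: (prob_bounded_integrable (probability_setT _) (M := 1)).
    exact: mc.
  by move=> x; rewrite ler_norml cos_geN1 cos_le1.
by have := integral_cos_normal_pdf s0 th a; rewrite sqr_sqrtr // /Rintegral.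
Qed.

(** * Measurable maps into column vectors *)

Section MeasurableVectors.
Context (R : realType) (d : nat).

(** Rational boxes form a countable basis of the topology. *)
Let rbox (i : 'cV[rat]_d * nat) : set 'cV[R]_d :=
  [set v | forall k, `|v k 0 - ratr (i.1 k 0)| < i.2.+1%:R^-1].

Let open_bigcup_rbox (U : set 'cV[R]_d) : open U ->
  U = \bigcup_(i in setT) (if `[< rbox i `<=` U >] then rbox i else set0).
Proof.
move=> oU; apply/seteqP; split => [v Uv|v [i _]]; last first.
  by case: asboolP => // H; exact: H.
have /nbhs_ballP[e /= e0 eU] : nbhs v U by exact: open_nbhs_nbhs.
pose n := Num.bound (2 / e).
have n2 : n.+1%:R^-1 * 2 < e.
  rewrite mulrC ltr_pdivrMr ?ltr0Sn // mulrC -ltr_pdivrMr //.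
  apply: (lt_trans (archi_boundP _)); first by rewrite divr_ge0 // ltW.
  by rewrite ltr_nat.
have Hq (k : 'I_d) : exists q : rat, `|v k 0 - ratr q| < n.+1%:R^-1.
  have n0 : 0 < n.+1%:R^-1 :> R by rewrite invr_gt0 ltr0Sn.
  have : (v k 0 : R) - n.+1%:R^-1 < v k 0 + n.+1%:R^-1.
    by rewrite ltrD2l (lt_trans _ n0) // oppr_lt0.
  move=> /rat_in_itvoo[q]; rewrite in_itv /= => vq.
  by exists q; rewrite distrC ltr_distl.
have [q qv] := choice Hq.
exists (\col_k q k, n) => //.
case: asboolP => [_ k|]; first by rewrite mxE; exact: qv.
case => u uq; apply: eU; split => // i j; rewrite (ord1 j) /ball /=.
have := uq i; have := qv i; rewrite /= mxE => h1 h2.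
rewrite (le_lt_trans (ler_distD (ratr (q i)) _ _)) //.
by rewrite (lt_trans _ n2) // mulr_natr mulr2n ltrD // distrC.
Qed.

(** An open set is a countable union of rational boxes, and the preimage of a
    box is given by finitely many conditions on coordinates. *)
Lemma measurable_cV dX (X : measurableType dX) (phi : X -> borel_cV R d) :
  (forall k, measurable_fun setT (fun x => phi x k 0 : R)) ->
  measurable_fun setT phi.
Proof.
move=> mphi; apply: (@measurability _ _ X (borel_cV R d) setT phi (@open 'cV[R]_d) erefl).
move=> _ [U oU <-]; rewrite setTI (open_bigcup_rbox oU) preimage_bigcup.
apply: countable_bigcupT_measurable => // i.
case: asboolP => _; last by rewrite preimage_set0.
apply: measurable_forall => k.
have mk : measurable_fun setT (fun x => `|(phi x k 0 : R) - ratr (i.1 k 0)|).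
  by apply: measurableT_comp => //; apply: measurable_funB.
have := mk measurableT _ (measurable_itv `]-oo, (i.2.+1%:R^-1 : R)[).
by rewrite setTI; congr measurable; apply/seteqP; split => x /=; rewrite in_itv.
Qed.

End MeasurableVectors.

Section Pushforward.
Context (R : realType) (d1 d2 : measure_display).
Context (T1 : measurableType d1) (T2 : measurableType d2).

Lemma push_probability (P : probability T1 R) (phi : T1 -> T2) :
  measurable_fun setT phi ->
  exists2 Q : probability T2 R, forall A, Q A = P (phi @^-1` A) &
    forall (f : T2 -> R) M, measurable_fun setT f -> (forall x, `|f x| <= M) ->
      \int[Q]_x f x = \int[P]_x f (phi x).
Proof.
move=> mphi.
pose X : {mfun T1 >-> T2} := MeasurableFun.Pack (MeasurableFun.Class
  (isMeasurableFun.Build _ _ _ _ _ mphi)).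
exists (distribution P X) => // f M mf fM.
rewrite /Rintegral integral_pushforward //=.
  exact/measurable_EFinP.
apply: (prob_bounded_integrable (probability_setT P) (M := M)) => //.
exact: measurableT_comp mf mphi.
Qed.

End Pushforward.

(** * Uniqueness on the line *)

Section LineUniqueness.
Context (R : realType).
Notation Rm := (measurableTypeR R).
Variables nu1 nu2 : probability Rm R.
Hypothesis eq_char : forall a th : R,
  \int[nu1]_x cos (a * x + th) = \int[nu2]_x cos (a * x + th).

Let line (x : Rm) : borel_cV R 1 := const_mx x.

Let line_measurable : measurable_fun setT line.
Proof.
by apply: measurable_cV => k; rewrite (_ : (fun x => _) = id) //; apply/funext => x; rewrite mxE.
Qed.

(** The constant sequence [nu1] converges weakly to [nu2], both being regarded as
    laws of vectors of dimension 1. *)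
Lemma eq_char_eq_integral (g : R -> R) M : continuous g -> (forall x, `|g x| <= M) ->
  \int[nu1]_x g x = \int[nu2]_x g x.
Proof.
move=> cg gM.
have [Q1 _ Q1E] := push_probability nu1 line_measurable.
have [Q2 _ Q2E] := push_probability nu2 line_measurable.
pose f (v : 'cV[R]_1) : R := g (v 0 0).
have cf : continuous f.
  by move=> v; apply: continuous_comp; [exact: coord_continuous|exact: cg].
have mf := continuous_measurable_cV cf.
have fM v : `|f v| <= M by exact: gM.
have fE (nu : probability Rm R) : \int[nu]_x g x = \int[nu]_x f (line x).
  by apply: eq_Rintegral => x _; rewrite /f mxE.
rewrite !fE -(Q1E f M mf fM) -(Q2E f M mf fM); apply: EFin_inj.
rewrite -(EFin_Rintegral (probability_setT Q1) mf fM).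
rewrite -(EFin_Rintegral (probability_setT Q2) mf fM).
have W : weak_cvg (fun=> Q1 : {measure set _ -> \bar R}) Q2.
  apply: char_weak_cvg => [n||t th|e e0].
  - exact: probability_setT.
  - exact: probability_setT.
  - have cM v : `|cos (dot t v + th)| <= 1 :> R.
      by rewrite ler_norml cos_geN1 cos_le1.
    have mc := continuous_measurable_cV (trigpoly_continuous (trigpoly_cos t th)).
    have EE (nu : probability Rm R) :
        \int[nu]_x cos (dot t (line x) + th) = \int[nu]_x cos (t 0 0 * x + th).
      by apply: eq_Rintegral => x _; rewrite dotE big_ord_recl big_ord0 addr0 mxE.
    rewrite (Q2E _ 1 mc cM) EE -eq_char -EE -(Q1E _ 1 mc cM); exact: cvg_cst.
  - have [L HL] := box_tight (probability_setT Q1) e0.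
    by exists L.
have c1 : (fun=> \int[Q1]_v (f v)%:E)%E @ \oo --> (\int[Q1]_v (f v)%:E)%E.
  exact: cvg_cst.
exact: (cvg_unique (@ereal_hausdorff R) c1 (W f cf (ex_intro _ M fM))).
Qed.

(** The indicator of the ray is the limit of the bounded continuous functions
    [1 - expR (- n * pos)], where [pos] is the positive part of [x - a]. *)
Lemma eq_char_eq_ray (a : R) : nu1 `]a, +oo[%classic = nu2 `]a, +oo[%classic.
Proof.
pose pos (x : R) := ((x - a) + `|x - a|) / 2.
pose g (n : nat) (x : R) : R := 1 - expR (- (n%:R * pos x)).
have pos0 x : 0 <= pos x.
  by rewrite /pos; have := ler_norm (- (x - a)); rewrite normrN => ?; lra.
have gM n x : `|g n x| <= 1.
  have h : expR (- (n%:R * pos x)) <= 1.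
    by rewrite -[leRHS]expR0 ler_expR oppr_le0 mulr_ge0.
  have := expR_ge0 (- (n%:R * pos x)) => ?.
  by rewrite /g ler_norml; apply/andP; split; lra.
have cg n : continuous (g n).
  move=> x; apply: cvgB; first exact: cvg_cst.
  apply: continuous_comp; last exact: continuous_expR.
  apply: cvgN; apply: cvgM (cvg_cst _) _.
  apply: cvgM (cvg_cst _); apply: cvgD; first exact: cvgB cvg_id (cvg_cst _).
  by apply: cvg_norm; exact: cvgB cvg_id (cvg_cst _).
have g_cvg x : g ^~ x @ \oo --> (\1_(`]a, +oo[%classic) x : R).
  rewrite indicE; have [ax|xa] := ltP a x.
    rewrite mem_set /= ?in_itv /= ?ax // -[X in _ --> X]subr0; apply: cvgB (cvg_cst _) _.
    have px : 0 < pos x by rewrite /pos ger0_norm ?subr_ge0 ?ltW //; lra.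
    rewrite (_ : (fun n => expR (- (n%:R * pos x))) = fun n => expR (- pos x) ^+ n).
      by apply: cvg_expr; rewrite ger0_norm ?expR_ge0 // -[ltRHS]expR0 ltr_expR oppr_lt0.
    by apply/funext => n; rewrite -mulrN expRM_natl.
  rewrite memNset /= ?in_itv /= ?andbT; last by apply/negP; rewrite -leNgt.
  rewrite (_ : g ^~ x = fun=> 0); first exact: cvg_cst.
  apply/funext => n; rewrite /g /pos ler0_norm ?subr_le0 // subrr mul0r mulr0.
  by rewrite oppr0 expR0 subrr.
have lim (nu : probability Rm R) :
    \int[nu]_x g n x @[n --> \oo] --> fine (nu `]a, +oo[%classic).
  have mg n := continuous_measurable_fun (cg n).
  have : (fun n => \int[nu]_x (g n x)%:E)%E @ \oo -->
      (\int[nu]_x (\1_(`]a, +oo[%classic) x)%:E)%E.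
    have ae1 : {ae nu, forall x, setT x ->
        (fun n => (g n x)%:E) @ \oo --> (\1_(`]a, +oo[%classic) x : R)%:E}.
      apply: aeW => x _; apply/fine_cvgP; split; first exact: nearW.
      exact: g_cvg.
    have ae2 : {ae nu, forall x n, setT x -> (`|(g n x)%:E| <= (EFin \o cst 1%R) x)%E}.
      by apply: aeW => x n _; rewrite /= lee_fin.
    have mgE n : measurable_fun setT (fun x : Rm => (g n x)%:E).
      by apply/measurable_EFinP; exact: mg.
    have m1E : measurable_fun setT (fun x : Rm => (\1_(`]a, +oo[%classic) x : R)%:E).
      by apply/measurable_EFinP; apply: measurable_indic; exact: measurable_itv.
    have i1 : nu.-integrable setT (EFin \o cst 1).
      apply: (prob_bounded_integrable (probability_setT nu) (M := 1)) => //.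
      by move=> x /=; rewrite normr1.
    by have [] := @dominated_convergence _ _ _ nu _ measurableT _ _ _ mgE m1E ae1 i1 ae2.
  have mI : measurable (`]a, +oo[%classic : set Rm) by exact: measurable_itv.
  rewrite integral_indic // setIT => H; apply: fine_cvg.
  by rewrite fineK // fin_num_measure.
have eqI : (fun n => \int[nu1]_x g n x) = (fun n => \int[nu2]_x g n x).
  by apply/funext => n; exact: eq_char_eq_integral (cg n) (gM n).
have mI : measurable (`]a, +oo[%classic : set Rm) by exact: measurable_itv.
have := cvg_unique (@Rhausdorff R) (lim nu1); rewrite eqI => /(_ _ _ (lim nu2)) E.
by rewrite -[LHS]fineK ?fin_num_measure // E fineK ?fin_num_measure.
Qed.

Lemma eq_char_eq_measure (A : set Rm) : measurable A -> nu1 A = nu2 A.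
Proof.
apply: (@measure_unique _ R Rm (@RGenOInfty.G R)
  (fun n => `]- n%:R, +oo[%classic)) => //.
- exact: RGenOInfty.measurableE.
- move=> _ _ [a ->] [b ->]; exists (Num.max a b).
  by apply/seteqP; split => x /=; rewrite !in_itv /= !andbT gt_max; [case=> -> ->|move=> /andP[]].
- by move=> n; exists (- n%:R).
- rewrite -subTset => x _; exists (Num.bound `|x|) => //=.
  rewrite in_itv /= andbT ltrNl; apply: le_lt_trans (archi_boundP (normr_ge0 x)).
  by rewrite ler_normr lexx orbT.
- by move=> _ [a ->]; exact: eq_char_eq_ray.
- by move=> n; rewrite ltey_eq fin_num_measure //; exact: measurable_itv.
Qed.

End LineUniqueness.

(** * Existence of multivariate normal laws *)

Section MultivariateNormal.
Context (R : realType) (d : nat).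

Let cos_bounded (t v : 'cV[R]_d) th : `|cos (dot t v + th)| <= 1.
Proof. by rewrite ler_norml cos_geN1 cos_le1. Qed.

Let cos_measurable (t : 'cV[R]_d) th :
  measurable_fun setT (fun v : borel_cV R d => cos (dot t v + th)).
Proof. exact: continuous_measurable_cV (trigpoly_continuous (trigpoly_cos t th)). Qed.

(** The law of the sum of independent standard normal multiples of the vectors
    of [l]. Each new vector is handled by a product measure, and multiplies the
    characteristic function by a Gaussian factor. *)
Lemma gaussian_exists (l : seq 'cV[R]_d) :
  exists mu : probability (borel_cV R d) R, forall t th,
    \int[mu]_v cos (dot t v + th) =
    cos th * expR (- ((\sum_(a <- l) dot t a ^+ 2) / 2)).
Proof.
elim: l => [|a l [mu IH]].
  exists (\d_(0 : borel_cV R d)) => t th.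
  rewrite big_nil mul0r oppr0 expR0 mulr1 /Rintegral integral_dirac //.
    by rewrite diracT mul1e /= dot0r add0r.
  exact/measurable_EFinP.
have [nu _ nuE] := normal_law_char (@ler01 R).
pose phi (p : borel_cV R d * measurableTypeR R) : borel_cV R d := p.1 + p.2 *: a.
have mphi : measurable_fun setT phi.
  apply: measurable_cV => k.
  rewrite (_ : (fun x => _) = fun p => (p.1 : 'cV[R]_d) k 0 + (p.2 : R) * a k 0); last first.
    by apply/funext => p; rewrite !mxE.
  apply: measurable_funD.
    exact: measurableT_comp (@coord_measurable R d k) measurable_fst.
  by apply: measurable_funM => //; exact: measurable_snd.
have [Q _ QE] := push_probability (mu \x nu)%E mphi.
exists Q => t th; rewrite (QE _ 1 (cos_measurable t th) (fun v => cos_bounded t v th)).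
have mf : measurable_fun setT (fun p => cos (dot t (phi p) + th)).
  exact: measurableT_comp (cos_measurable t th) mphi.
have intf : (mu \x nu)%E.-integrable setT (EFin \o (fun p => cos (dot t (phi p) + th))).
  apply: (prob_bounded_integrable (probability_setT _) (M := 1)).
    exact: mf.
  by move=> p; rewrite ler_norml cos_geN1 cos_le1.
have inner (v : borel_cV R d) :
    (\int[nu]_y (cos (dot t (phi (v, y)) + th))%:E =
     (cos (dot t v + th) * expR (- (dot t a ^+ 2 / 2)))%:E)%E.
  have mc : measurable_fun setT (fun y : measurableTypeR R => cos (dot t a * y + (dot t v + th))).
    apply: continuous_measurable_fun => x; apply: continuous_comp.
      by apply: cvgD (cvg_cst _); apply: cvgM (cvg_cst _) cvg_id.
    exact: continuous_cos.
  rewrite -(mulr1 (dot t a ^+ 2)) -nuE.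
  rewrite -(EFin_Rintegral (probability_setT nu) mc (M := 1)); last first.
    by move=> x; rewrite ler_norml cos_geN1 cos_le1.
  apply: eq_integral => y _; rewrite /phi /= dotDr dotZr.
  by congr (cos _)%:E; ring.
rewrite {1}/Rintegral -(integral12_prod_meas1 intf) /fubini_F /=.
under eq_integral do rewrite inner mulrC.
have -> : fine (\int[mu]_x (expR (- (dot t a ^+ 2 / 2)) * cos (dot t x + th))%:E)%E =
    \int[mu]_x (expR (- (dot t a ^+ 2 / 2)) * cos (dot t x + th)) by [].
rewrite RintegralZl //; last first.
  exact: (prob_bounded_integrable (probability_setT mu) (cos_measurable t th)
    (fun v => cos_bounded t v th)).
rewrite IH big_cons mulrCA -expRD; congr (_ * expR _).
by field.
Qed.

(** A projection of the law above has the characteristic function of a normal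
    law on the line, hence equals it. *)
Lemma mvnormal_exists (l : seq 'cV[R]_d) (S : 'M[R]_d) : S^T = S ->
  (forall t : 'cV[R]_d, (t^T *m S *m t) 0 0 = \sum_(a <- l) dot t a ^+ 2) ->
  exists mu : probability (borel_cV R d) R, is_mvnormal mu 0 S /\
    forall t th, \int[mu]_v cos (dot t v + th) =
      cos th * expR (- ((t^T *m S *m t) 0 0 / 2)).
Proof.
move=> Ssym Sl; have [mu muE] := gaussian_exists l.
exists mu; split; last by move=> t th; rewrite muE Sl.
split => // t; split.
  by rewrite Sl; apply: sumr_ge0 => a _; exact: sqr_ge0.
move=> A mA; rewrite mulmx0 mxE.
have v0 : 0 <= (t^T *m S *m t) 0 0 by rewrite Sl; apply: sumr_ge0 => a _; exact: sqr_ge0.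
have [nu nuE nuc] := normal_law_char v0.
have mdot : measurable_fun setT (dot t : borel_cV R d -> measurableTypeR R).
  exact: (continuous_measurable_cV (@dot_continuous R d t)).
have [Q QA QE] := push_probability mu mdot.
rewrite -nuE (_ : mu _ = Q A); last by rewrite QA.
apply: eq_char_eq_measure => // a th; rewrite nuc (QE _ 1); last 2 first.
- apply: continuous_measurable_fun => x; apply: continuous_comp.
    by apply: cvgD (cvg_cst _); apply: cvgM (cvg_cst _) cvg_id.
  exact: continuous_cos.
- by move=> x; rewrite ler_norml cos_geN1 cos_le1.
rewrite (@eq_Rintegral _ _ _ mu setT (fun v => cos (dot (a *: t) v + th))) => [|v _].
  rewrite muE Sl mulr_sumr.
  by under eq_bigr do rewrite dotZl exprMn.
by rewrite dotZl.
Qed.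

End MultivariateNormal.

(** * Strong law for pairwise independent events *)

Lemma between_squares (n : nat) : exists k, (k ^ 2 <= n < k.+1 ^ 2)%N.
Proof.
elim: n => [|n [k /andP[h1 h2]]]; first by exists 0%N.
have [h|h] := ltnP n.+1 (k.+1 ^ 2).
  by exists k; rewrite h andbT (leq_trans h1).
by exists k.+1; rewrite h /=; move: h1 h2 h; rewrite !expnS !expn0; nia.
Qed.

Section StrongLaw.
Context (R : realType) (dO : measure_display) (O : measurableType dO).
Variables (P : probability O R) (A : nat -> set O) (p : R).
Hypothesis mA : forall i, measurable (A i).
Hypothesis PA : forall i, P (A i) = p%:E.
Hypothesis PAA : forall i j, i != j -> P (A i `&` A j) = (p * p)%:E.

Let xi i (w : O) : R := \1_(A i) w - p.
Let D n (w : O) : R := \sum_(i < n) xi i w.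

Let p01 : 0 <= p <= 1.
Proof.
by rewrite -!lee_fin -(PA 0) measure_ge0 probability_le1.
Qed.

Let m_ind i : measurable_fun setT (\1_(A i) : O -> R).
Proof. exact: measurable_indic. Qed.

Let m_xi i : measurable_fun setT (xi i).
Proof. by apply: measurable_funB. Qed.

Let xi_le i w : `|xi i w| <= 1.
Proof.
have /andP[? ?] := p01; rewrite /xi indicE ler_norml.
by case: (w \in A i) => /=; apply/andP; split; rewrite ?mulr1n ?mulr0n; lra.
Qed.

Let m_D n : measurable_fun setT (D n).
Proof. by apply: measurable_sum. Qed.

Let D_le n w : `|D n w| <= n%:R.
Proof.
rewrite (le_trans (ler_norm_sum _ _ _)) //.
apply: (@le_trans _ _ (\sum_(i < n) 1)); last by rewrite sumr_const card_ord.
by apply: ler_sum => i _; exact: xi_le.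
Qed.

Let int_bounded (f : O -> R) M : measurable_fun setT f -> (forall w, `|f w| <= M) ->
  P.-integrable setT (EFin \o f).
Proof. by move=> mf fM; exact: (prob_bounded_integrable (probability_setT P) mf fM). Qed.

Let int_ind (B : set O) r : measurable B -> P B = r%:E -> \int[P]_w \1_B w = r.
Proof. by move=> mB PB; rewrite /Rintegral integral_indic // setIT; exact: (f_equal fine PB). Qed.

Let int_cst (c : R) : \int[P]_w c = c.
Proof.
rewrite Rintegral_cst // -[RHS]mulr1; congr (_ * _).
exact: (f_equal fine (probability_setT P)).
Qed.

Let cov0 i j : i != j -> \int[P]_w (xi i w * xi j w) = 0.
Proof.
move=> ij.
rewrite (@eq_Rintegral _ _ _ P setT (fun w => \1_(A i `&` A j) w +
  ((- p) * \1_(A i) w + ((- p) * \1_(A j) w + p * p)))); last first.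
  by move=> w _; rewrite /xi indicI /=; ring.
have iI B : measurable B -> P.-integrable setT (EFin \o (\1_B : O -> R)).
  move=> mB; apply: (int_bounded (M := 1)); first exact: measurable_indic.
  by move=> w; rewrite indicE ger0_norm ?ler0n //; case: (_ \in _).
have iZ B : measurable B -> P.-integrable setT (EFin \o (fun w => (- p) * \1_B w : R)).
  by move=> mB; exact: (integrableZl measurableT (- p) (iI B mB)).
have iC : P.-integrable setT (EFin \o (fun=> p * p)).
  exact: (int_bounded (M := `|p * p|)).
have i2 := integrableD measurableT (iZ _ (mA j)) iC.
have i3 := integrableD measurableT (iZ _ (mA i)) i2.
rewrite (RintegralD measurableT (iI _ (measurableI _ _ (mA i) (mA j))) i3).
rewrite (RintegralD measurableT (iZ _ (mA i)) i2).
rewrite (RintegralD measurableT (iZ _ (mA j)) iC).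
rewrite (RintegralZl (- p) measurableT (iI _ (mA i))).
rewrite (RintegralZl (- p) measurableT (iI _ (mA j))).
rewrite (int_ind _ (PAA ij)); last exact: measurableI.
rewrite (int_ind _ (PA i)) // (int_ind _ (PA j)) //.
rewrite int_cst; ring.
Qed.

Let covD n m : (n <= m)%N -> \int[P]_w (D n w * xi m w) = 0.
Proof.
elim: n => [|n IHn] nm.
  rewrite (@eq_Rintegral _ _ _ P setT (fun=> 0)); last first.
    by move=> w _; rewrite /D big_ord0 mul0r.
  exact: int_cst.
rewrite (@eq_Rintegral _ _ _ P setT (fun w => D n w * xi m w + xi n w * xi m w)).
  rewrite RintegralD //.
  - by rewrite IHn ?(ltnW nm) // cov0 ?addr0 // ltn_eqF.
  - apply: (int_bounded (M := n%:R)); first exact: measurable_funM.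
    by move=> w; rewrite normrM -[leRHS]mulr1 ler_pM.
  - apply: (int_bounded (M := 1)); first exact: measurable_funM.
    by move=> w; rewrite normrM mulr_ile1.
by move=> w _; rewrite /D big_ord_recr /= mulrDl.
Qed.

Let varD n : \int[P]_w (D n w ^+ 2) <= n%:R.
Proof.
elim: n => [|n IHn].
  rewrite (@eq_Rintegral _ _ _ P setT (fun=> 0)); last first.
    by move=> w _; rewrite /D big_ord0 expr0n.
  by rewrite int_cst.
rewrite (@eq_Rintegral _ _ _ P setT
  (fun w => D n w ^+ 2 + (2 * (D n w * xi n w) + xi n w ^+ 2))); last first.
  by move=> w _; rewrite /D big_ord_recr /=; ring.
have iDx : P.-integrable setT (EFin \o (fun w => D n w * xi n w)).
  apply: (int_bounded (M := n%:R)); first exact: measurable_funM.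
  by move=> w; rewrite normrM -[leRHS]mulr1 ler_pM.
have iD2 : P.-integrable setT (EFin \o (fun w => D n w ^+ 2)).
  apply: (int_bounded (M := n%:R ^+ 2)); first exact: measurable_funX.
  by move=> w; rewrite normrX lerXn2r ?nnegrE.
have ix2 : P.-integrable setT (EFin \o (fun w => xi n w ^+ 2)).
  apply: (int_bounded (M := 1)); first exact: measurable_funX.
  by move=> w; rewrite normrX exprn_ile1.
have i2 := integrableD measurableT (integrableZl measurableT 2 iDx) ix2.
rewrite RintegralD // RintegralD //; last exact: (integrableZl measurableT 2 iDx).
rewrite RintegralZl // covD // mulr0 add0r -[n.+1%:R]natr1 lerD //.
rewrite -[leRHS](int_cst 1).
apply: le_Rintegral => //.
  by apply: (int_bounded (M := `|1|)).
by move=> w _; rewrite /= -(real_normK (num_real _)) exprn_ile1.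
Qed.

Let f k w := (D (k.+1 ^ 2) w / (k.+1 ^ 2)%:R) ^+ 2.

Let f_ge0 k w : 0 <= f k w. Proof. exact: sqr_ge0. Qed.

Let m_f k : measurable_fun setT (f k).
Proof. by apply: measurable_funX; apply: measurable_funM. Qed.

Let int_f k : (\int[P]_w (f k w)%:E <= (k.+1 ^ 2)%:R^-1%:E)%E.
Proof.
set N := (k.+1 ^ 2)%N.
have N0 : (0 : R) < N%:R by rewrite ltr0n expn_gt0.
have fM w : `|f k w| <= 1.
  rewrite ger0_norm // /f -(real_normK (num_real _)) exprn_ile1 //.
  by rewrite normrM [`|_^-1|]ger0_norm ?invr_ge0 // ler_pdivrMr // mul1r D_le.
rewrite (EFin_Rintegral (probability_setT P) (m_f k) fM) lee_fin.
rewrite (@eq_Rintegral _ _ _ P setT (fun w => N%:R ^- 2 * D N w ^+ 2)); last first.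
  by move=> w _; rewrite /f -/N expr_div_n mulrC.
rewrite RintegralZl //; last first.
  apply: (int_bounded (M := N%:R ^+ 2)); first exact: measurable_funX.
  by move=> w; rewrite normrX lerXn2r ?nnegrE.
rewrite -ler_pdivlMl ?invr_gt0 ?exprn_gt0 // invrK.
by rewrite expr2 mulfK ?gt_eqF.
Qed.

Let sum_inv_sq n : \sum_(0 <= k < n) ((k.+1 ^ 2)%:R^-1 : R) <= 2.
Proof.
(* Telescoping bound; for n = 0 it relies on the inverse of 0 being 0. *)
suff: \sum_(0 <= k < n) ((k.+1 ^ 2)%:R^-1 : R) <= 2 - n%:R^-1.
  by move/le_trans; apply; rewrite gerBl invr_ge0.
elim: n => [|[|n] IHn]; first by rewrite big_nil invr0; lra.
  by rewrite big_nat1 invr1; lra.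
rewrite big_nat_recr //=; apply: le_trans (lerD IHn (lexx _)) _.
rewrite natrX -[n.+2%:R]natr1 -addrA lerD2l.
have := ltr0Sn R n; set x := n.+1%:R => x0.
rewrite -subr_ge0 (_ : _ - _ = (x * (x + 1) ^+ 2)^-1).
  by rewrite invr_ge0 mulr_ge0 ?sqr_ge0 // ltW.
by field; rewrite gt_eqF //= gt_eqF // addr_gt0.
Qed.

(** The sum over [k] of the [f k] has finite mean, so it is finite almost surely
    and its terms tend to 0. *)
Let ae_f_cvg : {ae P, forall w, f k w @[k --> \oo] --> 0}.
Proof.
pose F w := (\sum_(k <oo) (f k w)%:E)%E.
have mf k : measurable_fun setT (EFin \o f k) by apply/measurable_EFinP.
have f0 k w : (0 <= (f k w)%:E)%E by rewrite lee_fin.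
have intF : (\int[P]_w F w <= 2%:E)%E.
  rewrite /F integral_nneseries //.
  apply: lime_le.
    by apply: is_cvg_nneseries => k _ _; apply: integral_ge0.
  apply: nearW => n.
  apply: le_trans (lee_sum _ (fun k _ => int_f k)) _.
  by rewrite sumEFin lee_fin sum_inv_sq.
have F0 w : (0 <= F w)%E by apply: nneseries_ge0.
have mF : measurable_fun setT F.
  by apply: ge0_emeasurable_sum => // k _; exact: mf.
have iF : P.-integrable setT F.
  apply/integrableP; split => //.
  under eq_integral do rewrite gee0_abs //.
  by rewrite (le_lt_trans intF) // ltry.
have := integrable_ae measurableT iF; apply: filterS => w /(_ I) Fw.
apply: cvg_series_cvg_0.
apply: nondecreasing_is_cvgn.
  by apply/nondecreasing_seqP => n; rewrite /series /= big_nat_recr //= lerDl.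
exists (fine (F w)) => _ [n _ <-].
rewrite -lee_fin fineK // /series /= -sumEFin.
exact: nneseries_lim_ge.
Qed.

(** Along squares the variances are summable; between consecutive squares the
    centred count moves by at most the length of the gap, which is negligible. *)
Lemma strong_law_events :
  {ae P, forall w, (\sum_(i < n) \1_(A i) w) / n%:R @[n --> \oo] --> p}.
Proof.
apply: filterS ae_f_cvg => w fw.
(* Each centred indicator is at most 1 in absolute value. *)
have gap n m : (n <= m)%N -> `|D m w| <= `|D n w| + (m - n)%:R.
  move=> nm; rewrite -(subnKC nm) addKn; elim: (m - n)%N => [|k IHk].
    by rewrite addn0 addr0.
  rewrite addnS /D big_ord_recr /= -/(D (n + k) w) (le_trans (ler_normD _ _)) //.
  by rewrite -[k.+1%:R]natr1 addrA lerD.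
have sq k : `|D (k.+1 ^ 2) w / (k.+1 ^ 2)%:R| = Num.sqrt (f k w).
  by rewrite /f sqrtr_sqr.
apply/cvgrPdist_le => e e0.
have e2 : 0 < e / 2 by rewrite divr_gt0.
have e22 : 0 < (e / 2) ^+ 2 by rewrite exprn_gt0.
have /cvgrPdist_le /(_ _ e22)[K1 _ HK1] := fw.
(* If k^2 <= n < (k+1)^2 then n - k^2 <= 2 k, and 2 k <= (e/2) k^2 once
   k >= 4 / e. *)
pose K2 := Num.bound (4 / e).
pose K := (maxn K1 K2).+1.
exists (K ^ 2)%N => // n /= Kn.
have [k /andP[kn nk]] := between_squares n.
have Kk : (K <= k)%N.
  by rewrite -ltnS -(ltn_exp2r _ _ (isT : 0 < 2)%N) (leq_ltn_trans Kn).
have k0 : (0 < k)%N by rewrite (leq_trans _ Kk).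
have n0 : (0 : R) < n%:R.
  by rewrite ltr0n (leq_trans _ kn) // expn_gt0 k0.
have -> : p - (\sum_(i < n) \1_(A i) w) / n%:R = - (D n w / n%:R).
  rewrite /D sumrB sumr_const card_ord -[_ *+ n]mulr_natr; field.
  by rewrite gt_eqF.
rewrite normrN normrM [`|_^-1|]ger0_norm ?invr_ge0 ?(ltW n0) // ler_pdivrMr //.
apply: le_trans (gap _ _ kn) _.
have k2n : ((k ^ 2)%:R : R) <= n%:R by rewrite ler_nat.
have k20 : (0 : R) < (k ^ 2)%:R by rewrite ltr0n expn_gt0 k0.
rewrite [e]splitr mulrDl lerD //.
  apply: (@le_trans _ _ (e / 2 * (k ^ 2)%:R)); last by rewrite ler_wpM2l // ltW.
  rewrite -ler_pdivrMr // -[X in _ / X]ger0_norm ?(ltW k20) // -normfV -normrM.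
  have := HK1 k.-1; rewrite /= -ltnS prednK //.
  move=> /(_ (leq_trans (leq_maxl _ _ : K1 < K)%N Kk)).
  rewrite sub0r normrN ger0_norm // => fk.
  rewrite -{1 2}(prednK k0) sq -(ger0_norm (ltW e2)) -sqrtr_sqr.
  by rewrite ler_wsqrtr.
apply: (@le_trans _ _ (2 * k%:R)).
  by rewrite -natrM ler_nat; move: nk; rewrite !expnS !expn0; lia.
apply: (@le_trans _ _ (e / 2 * (k ^ 2)%:R)); last by rewrite ler_wpM2l // ltW.
have kR : (0 : R) < k%:R by rewrite ltr0n.
rewrite natrX expr2 mulrA ler_pM2r // mulrC.
have : 4 / e <= k%:R.
  apply/ltW/(lt_le_trans (archi_boundP _)); first by rewrite divr_ge0 // ltW.
  by rewrite ler_nat (leq_trans _ Kk) // /K ltnW // ltnS leq_maxr.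
rewrite ler_pdivrMr // => h; lra.
Qed.

End StrongLaw.

(** * Finite mixtures and kernels *)

Section FiniteMixture.
Context (R : realType) (dT : measure_display) (T : measurableType dT).

Let mixture_seq (l : seq ({nonneg R} * T)) :
  exists m : {measure set T -> \bar R},
    (forall B, m B = \sum_(a <- l) (a.1%:num * \1_B a.2)%:E)%E /\
    (forall f : T -> \bar R, measurable_fun setT f -> (forall x, 0 <= f x)%E ->
      \int[m]_x f x = \sum_(a <- l) a.1%:num%:E * f a.2)%E.
Proof.
elim: l => [|a l [m [mB mI]]].
  exists mzero; split => [B|f mf f0]; rewrite big_nil //.
  by rewrite integral_measure_zero.
exists (measure_add (mscale a.1 (\d_(a.2))) m); split => [B|f mf f0].
  rewrite big_cons -mB EFinM; exact: measure_addE.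
rewrite ge0_integral_measure_add //.
rewrite big_cons mI // ge0_integral_mscale //.
by rewrite integral_dirac // diracT mul1e.
Qed.

(** The integral formula is stated for bounded functions of either sign; it
    follows from the nonnegative case by adding the bound. *)
Lemma mixture_exists (I : finType) (q : I -> R) (x : I -> T) :
  (forall i, 0 <= q i) -> \sum_i q i = 1 ->
  exists m : {measure set T -> \bar R},
    (forall B, m B = (\sum_i q i * \1_B (x i))%:E) /\
    (forall (f : T -> R) M, measurable_fun setT f -> (forall y, `|f y| <= M) ->
      \int[m]_y f y = \sum_i q i * f (x i)).
Proof.
move=> q0 q1.
have [m [mB mI]] := mixture_seq [seq (NngNum (q0 i), x i) | i <- index_enum I].
have mBE B : m B = (\sum_i q i * \1_B (x i))%:E by rewrite mB big_map sumEFin.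
have m1 : m setT = 1%E.
  rewrite mBE; congr EFin; rewrite -q1; apply: eq_bigr => i _.
  by rewrite indicT mulr1.
exists m; split => // f M mf fM.
have fM0 y : 0 <= f y + M.
  by have := fM y; rewrite ler_norml => /andP[? _]; rewrite addrC -lerBlDl sub0r.
have mfM : measurable_fun setT (fun y => f y + M) by exact: measurable_funD.
have iM : m.-integrable setT (EFin \o (fun=> M)).
  by apply: (prob_bounded_integrable m1 (M := `|M|)).
have ifM := prob_bounded_integrable m1 mf fM.
have : \int[m]_y (f y + M) = \int[m]_y f y + M.
  rewrite RintegralD // Rintegral_cst //; congr (_ + _).
  by rewrite -[RHS]mulr1; congr (_ * _); exact: (f_equal fine m1).
rewrite {1}/Rintegral mI //; last by apply/measurable_EFinP.
rewrite big_map (eq_bigr (fun i => (q i * f (x i) + q i * M)%:E)); last first.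
  by move=> i _; rewrite /= -EFinM mulrDr.
rewrite sumEFin /= big_split /= -mulr_suml q1 mul1r.
by move=> /addIr.
Qed.

End FiniteMixture.

Section FiniteKernel.
Context (R : realType) (dS dT : measure_display).
Context (S : measurableType dS) (T : measurableType dT) (U : finType).
Variables (Uf : S -> U) (m : U -> {measure set T -> \bar R}).
Hypothesis mU : discrete_rv Uf.
Hypothesis m1 : forall u, m u setT = 1%E.

Lemma discrete_comp_measurable (dE : measure_display) (E : measurableType dE)
    (h : U -> E) : measurable_fun setT (fun w => h (Uf w)).
Proof.
move=> _ B mB; rewrite setTI.
rewrite (_ : _ @^-1` B = \bigcup_(u in [set u | B (h u)]) (Uf @^-1` [set u])).
  by apply: fin_bigcup_measurable => // u _; exact: mU.
by apply/seteqP; split => [w /= Bw|w [u /= Bu ->]] //; exists (Uf w).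
Qed.

(** The hypotheses are arguments because the kernel structure attached to this
    function depends on them. *)
Definition finite_kernel_of (_ : discrete_rv Uf) (_ : forall u, m u setT = 1%E)
  (w : S) : {measure set T -> \bar R} := m (Uf w).

Let finite_kernel_measurable B : measurable B ->
  measurable_fun [set: S] (finite_kernel_of mU m1 ^~ B).
Proof. by move=> mB; exact: (discrete_comp_measurable (fun u => m u B)). Qed.

HB.instance Definition _ := isKernel.Build _ _ _ _ _ (finite_kernel_of mU m1)
  finite_kernel_measurable.

Let finite_kernel_prob w : finite_kernel_of mU m1 w setT = 1%E.
Proof. exact: m1. Qed.

HB.instance Definition _ := Kernel_isProbability.Build _ _ _ _ _
  (finite_kernel_of mU m1) finite_kernel_prob.

Lemma finite_kernel_exists :
  exists kappa : R.-pker S ~> T, forall w, kappa w = m (Uf w).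
Proof. by exists (finite_kernel_of mU m1). Qed.

End FiniteKernel.

(** * Conditional laws of finitely valued vectors *)

Section Partition.
Context (R : realType) (dO : measure_display) (O : measurableType dO).
Context (P : probability O R) (T : finType) (W : O -> T).
Hypothesis mW : discrete_rv W.

Lemma integral_partition (D : set O) (f : O -> \bar R) : measurable D ->
  measurable_fun setT f -> (forall w, 0 <= f w)%E ->
  (\int[P]_(w in D) f w = \sum_t \int[P]_(w in D `&` W @^-1` [set t]) f w)%E.
Proof.
move=> mD mf f0.
rewrite (eq_bigr (fun t => \int[P]_(w in D) (f \_ (W @^-1` [set t])) w)%E); last first.
  by move=> t _; rewrite integral_mkcondr.
rewrite -ge0_integral_sum //.
- apply: eq_integral => w _; rewrite (bigD1 (W w)) //= big1 => [|t tW].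
    by rewrite patchE mem_set // adde0.
  by rewrite patchE memNset // => /= Wt; rewrite Wt eqxx in tW.
- move=> t; apply: measurable_funTS; apply/(measurable_restrictT _ _).1 => //.
  exact: measurable_funTS.
- by move=> t w _; rewrite patchE; case: ifP.
Qed.

Lemma probability_partition (A : set O) : measurable A ->
  (P A = \sum_t P (A `&` W @^-1` [set t]))%E.
Proof.
move=> mA; have := @integral_partition A (cst 1%E) mA (measurable_cst _) (fun=> lee01).
rewrite integral_cst // mul1e => ->; apply: eq_bigr => t _.
by rewrite integral_cst ?mul1e //; apply: measurableI => //; exact: mW.
Qed.

End Partition.

Lemma measurable_point (R : realType) (d : nat) (v : borel_cV R d) :
  measurable [set v].
Proof.
rewrite (_ : [set v] = [set u : borel_cV R d | forall k, u k 0 = v k 0]).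
  apply: measurable_forall => k.
  by have := @coord_measurable R d k measurableT _ (measurable_set1 (v k 0)); rewrite setTI.
by apply/seteqP; split => [u ->|u uv] //; apply/colP.
Qed.

Section ConditionalLaw.
Context (R : realType) (dO : measure_display) (O : measurableType dO).
Context (P : probability O R) (G : set (set O)).
Hypothesis G_measurable : forall D, <<s G >> D -> measurable D.
Context (T X : finType) (d : nat).
Variables (U : O -> T) (Xi : O -> X) (wt : T -> X -> R) (vec : X -> T -> 'cV[R]_d).
Hypothesis U_G : forall u, <<s G >> (U @^-1` [set u]).
Hypothesis mXi : discrete_rv Xi.
Hypothesis wt_ge0 : forall u x, 0 <= wt u x.
Hypothesis wt_sum1 : forall u, \sum_x wt u x = 1.
Hypothesis wt_cond : forall x,
  is_cond_prob P G (Xi @^-1` [set x]) (fun w => wt (U w) x).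

Notation S := (g_sigma_algebraType G).

Let V (w : O) : 'cV[R]_d := vec (Xi w) (U w).

Let mixture (w : O) (B : set (borel_cV R d)) : R :=
  \sum_x wt (U w) x * \1_B (vec x (U w)).

Let mU : discrete_rv U.
Proof. by move=> u; apply: G_measurable; exact: U_G. Qed.

Let U_S : discrete_rv (U : S -> T). Proof. exact: U_G. Qed.

Let GI (D E : set O) : <<s G >> D -> <<s G >> E -> <<s G >> (D `&` E).
Proof. exact: (@measurableI _ S). Qed.

Let m_of_U (h : T -> R) : measurable_fun setT (fun w : O => h (U w)).
Proof. exact: (discrete_comp_measurable mU h). Qed.

(** Split [D] according to the values of [U] and [Xi]. On each piece the vector
    is constant, and the mass of the piece is given by [wt_cond]. *)
Lemma mixture_cond (D : set O) (B : set (borel_cV R d)) :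
  <<s G >> D -> measurable B ->
  (\int[P]_(w in D) (mixture w B)%:E = P (D `&` V @^-1` B))%E.
Proof.
move=> GD mB; have mD := G_measurable GD.
have mV : measurable (V @^-1` B).
  rewrite (_ : V @^-1` B = \bigcup_(u in setT) \bigcup_(x in [set x | B (vec x u)])
    (U @^-1` [set u] `&` Xi @^-1` [set x])).
    apply: fin_bigcup_measurable => // u _; apply: fin_bigcup_measurable => // x _.
    by apply: measurableI; [exact: mU|exact: mXi].
  apply/seteqP; split => [w Bw|w [u _ [x /= Bx [Uu Xx]]]].
    by exists (U w) => //; exists (Xi w).
  by rewrite /= /V Uu Xx.
have mix0 w : 0 <= mixture w B.
  by apply: sumr_ge0 => x _; rewrite mulr_ge0.
have mmix : measurable_fun setT (fun w => (mixture w B)%:E).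
  apply/measurable_EFinP.
  exact: (m_of_U (fun u => \sum_x wt u x * \1_B (vec x u))).
rewrite (integral_partition P mU mD mmix); last by move=> w; rewrite lee_fin.
rewrite (probability_partition P mU); last exact: measurableI.
apply: eq_bigr => u _.
have GDu : <<s G >> (D `&` U @^-1` [set u]) by apply: GI.
have mDu := G_measurable GDu.
rewrite (probability_partition P mXi); last by apply: measurableI; [exact: measurableI|exact: mU].
transitivity (\int[P]_(w in D `&` U @^-1` [set u])
    (\sum_x (\1_B (vec x u))%:E * (wt (U w) x)%:E))%E.
  apply: eq_integral => w /set_mem [_ /= Uw].
  by rewrite /mixture -sumEFin Uw; apply: eq_bigr => x _; rewrite muleC.
have mw x : measurable_fun (D `&` U @^-1` [set u]) (fun w => (wt (U w) x)%:E).
  by apply: measurable_funTS; apply/measurable_EFinP; exact: (m_of_U (fun u => wt u x)).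
transitivity (\sum_x \int[P]_(w in D `&` U @^-1` [set u])
    ((\1_B (vec x u))%:E * (wt (U w) x)%:E))%E.
  apply: ge0_integral_sum => // x; first exact: measurable_funeM.
  by move=> w _; rewrite mule_ge0 // lee_fin.
apply: eq_bigr => x _.
transitivity ((\1_B (vec x u))%:E *
    \int[P]_(w in D `&` U @^-1` [set u]) (wt (U w) x)%:E)%E.
  by apply: ge0_integralZl => // w _; rewrite lee_fin.
rewrite (wt_cond x).2 // indicE.
have [Bx|nBx] := pselect (B (vec x u)).
  rewrite mem_set // mul1e; congr (P _); apply/seteqP; split => w /=.
    by move=> [[Dw Uw] Xw]; rewrite /V Uw Xw.
  by move=> [[[Dw _] Uw] Xw].
rewrite memNset // mul0e; apply/esym; rewrite (_ : _ `&` _ = set0) ?measure0 //.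
rewrite -subset0 => w /= [[[_ BV] Uw] Xw]; apply: nBx.
by rewrite -Uw -Xw.
Qed.

Lemma cond_law_exists :
  exists kappa : R.-pker S ~> (borel_cV R d), is_cond_law P V kappa.
Proof.
have /choice[m mE] : forall u, exists m : {measure set (borel_cV R d) -> \bar R},
    forall B, m B = (\sum_x wt u x * \1_B (vec x u))%:E.
  move=> u; have [m [mB _]] := mixture_exists (fun x => vec x u : borel_cV R d)
    (wt_ge0 u) (wt_sum1 u).
  by exists m.
have m1 u : m u setT = 1%E.
  rewrite mE; congr EFin; rewrite -(wt_sum1 u); apply: eq_bigr => x _.
  by rewrite indicT mulr1.
have [kappa kE] := finite_kernel_exists U_S m1.
exists kappa => D B GD mB.
rewrite -mixture_cond //; apply: eq_integral => w _.
by rewrite kE mE.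
Qed.

(** On the image of [P] under the identity into the smaller sigma-algebra, the
    hypothesis becomes equality of the integrals over all measurable sets. *)
Lemma sub_sigma_ae_eq (h1 h2 : S -> \bar R) :
  measurable_fun setT h1 -> measurable_fun setT h2 ->
  (forall w, 0 <= h1 w <= 1)%E -> (forall w, 0 <= h2 w <= 1)%E ->
  (forall D, <<s G >> D -> \int[P]_(w in D) h1 w = \int[P]_(w in D) h2 w)%E ->
  {ae P, forall w, h1 w = h2 w}.
Proof.
move=> mh1 mh2 h1b h2b h12.
have mid : measurable_fun setT (id : O -> S).
  by move=> _ B GB; rewrite setTI; exact: G_measurable.
have [Q QE _] := push_probability P mid.
have IQ (h : S -> \bar R) D : measurable_fun setT h -> (forall w, 0 <= h w)%E ->
    <<s G >> D -> (\int[Q]_(w in D) h w = \int[P]_(w in D) h w)%E.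
  move=> mh h0 GD.
  pose X0 : {mfun O >-> S} := MeasurableFun.Pack (MeasurableFun.Class
    (isMeasurableFun.Build _ _ _ _ _ mid)).
  rewrite (eq_measure_integral (pushforward P X0)); last by move=> A _ _; exact: QE.
  rewrite ge0_integral_pushforward //.
  exact: measurable_funTS.
have ae0 : ae_eq Q setT h1 h2.
  apply: integral_ae_eq => //.
  - apply/integrableP; split => //.
    apply: (@le_lt_trans _ _ (\int[Q]_w cst 1 w)%E); last first.
      by rewrite integral_cst // mul1e ltey_eq fin_num_measure.
    apply: ge0_le_integral => //.
    + exact: measurableT_comp.
    + by move=> w _; have /andP[h0 hle] := h1b w; rewrite gee0_abs.
  - move=> E _ GE; rewrite !IQ //; first exact: h12.
      by move=> w; have /andP[] := h2b w.
    by move=> w; have /andP[] := h1b w.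
case: ae0 => N [GN QN sub].
exists N; split => //; first exact: G_measurable.
  exact: (etrans (esym (QE N)) QN).
by move=> w /= nw; apply: sub => /= /(_ I).
Qed.

(** A single null set must serve all [B]. The mixture is carried by finitely
    many atoms, so agreement on the finitely many sets of atoms, one null set
    for each, bounds [kappa w B] below by the mixture for all [B]; both being
    probabilities, the same bound for the complement gives equality. *)
Lemma cond_law_mixture (kappa : R.-pker S ~> (borel_cV R d)) :
  is_cond_law P V kappa ->
  {ae P, forall w : O, forall B, measurable B -> kappa w B = (mixture w B)%:E}.
Proof.
move=> kV.
(* Sets of atoms are indexed by sets of values of [Xi]; finitely many. *)
pose atoms (u : T) (C : {set X}) : set (borel_cV R d) :=
  \bigcup_(x in [set x | x \in C]) [set vec x u].
have m_atoms u C : measurable (atoms u C).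
  by apply: fin_bigcup_measurable => // x _; exact: measurable_point.
have mix01 w B : 0 <= mixture w B <= 1.
  apply/andP; split; first by apply: sumr_ge0 => x _; rewrite mulr_ge0.
  rewrite -(wt_sum1 (U w)); apply: ler_sum => x _; rewrite -[leRHS]mulr1.
  by rewrite ler_wpM2l // indicE; case: (_ \in _).
have ae_atoms : {ae P, forall w : O, forall uC : T * {set X},
    kappa w (atoms uC.1 uC.2) = (mixture w (atoms uC.1 uC.2))%:E}.
  apply: filter_forall => -[u C] /=.
  apply: (@sub_sigma_ae_eq (fun w => kappa w (atoms u C))
    (fun w => (mixture w (atoms u C))%:E)).
  - exact: measurable_kernel.
  - apply/measurable_EFinP.
    exact: (discrete_comp_measurable U_S
      (fun t => \sum_x wt t x * \1_(atoms u C) (vec x t) : R)).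
  - move=> w; rewrite measure_ge0 /= -(@prob_kernel _ _ _ _ _ kappa w).
    by apply: le_measure; rewrite ?inE.
  - by move=> w; rewrite !lee_fin.
  - by move=> D GD; rewrite kV // mixture_cond.
apply: filterS ae_atoms => w Hw.
have lower B : measurable B -> ((mixture w B)%:E <= kappa w B)%E.
  move=> mB; pose C := [set x : X | `[< B (vec x (U w)) >]]%SET.
  have atomsE x : atoms (U w) C (vec x (U w)) <-> B (vec x (U w)).
    split=> [[y /= ]|Bx]; first by rewrite inE => /asboolP By ->.
    by exists x => //=; rewrite inE; apply/asboolP.
  rewrite (_ : mixture w B = mixture w (atoms (U w) C)).
    have mA := m_atoms (U w) C.
    have AB : atoms (U w) C `<=` B by move=> _ [y /= + ->]; rewrite inE => /asboolP.
    by rewrite -(Hw (U w, C)); apply: le_measure; rewrite ?inE.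
  apply: eq_bigr => x _; congr (_ * _); rewrite !indicE; congr (nat_of_bool _)%:R.
  by apply/idP/idP => /set_mem H; apply/mem_set; [exact: (atomsE x).2|exact: (atomsE x).1].
move=> B mB; have mB' : measurable (~` B) by exact: measurableC.
have fk E : measurable E -> kappa w E \is a fin_num.
  by move=> mE; apply: (total1_fin_num (@prob_kernel _ _ _ _ _ kappa w)).
have k1 : fine (kappa w B) + fine (kappa w (~` B)) = 1.
  rewrite -fineD ?fk // -measureU //; last by rewrite setICr.
  by rewrite setUv; exact: (f_equal fine (@prob_kernel _ _ _ _ _ kappa w)).
have x1 : mixture w B + mixture w (~` B) = 1.
  rewrite -(wt_sum1 (U w)) -big_split /=; apply: eq_bigr => x _.
  by rewrite -mulrDr !indicE in_setC; case: (_ \in _); rewrite /= ?addr0 ?add0r mulr1.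
have := lower _ mB; have := lower _ mB'.
rewrite -(fineK (fk _ mB)) -(fineK (fk _ mB')) !lee_fin => l1 l2.
by congr EFin; lra.
Qed.

Lemma cond_law_integral (kappa : R.-pker S ~> (borel_cV R d)) :
  is_cond_law P V kappa ->
  {ae P, forall w : O, forall (f : 'cV[R]_d -> R) M,
    measurable_fun setT (f : borel_cV R d -> R) -> (forall v, `|f v| <= M) ->
    \int[kappa w]_v f v = \sum_x wt (U w) x * f (vec x (U w))}.
Proof.
move=> /cond_law_mixture; apply: filterS => w Hw f M mf fM.
have [m [mB mI]] := mixture_exists (fun x => vec x (U w) : borel_cV R d)
  (wt_ge0 (U w)) (wt_sum1 (U w)).
rewrite -(mI f M mf fM); congr fine; apply: eq_measure_integral => B mB' _.
by rewrite mB; exact: Hw.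
Qed.

End ConditionalLaw.

(** * Central limit theorem along a fixed data sequence *)

Section Resampling.
Context (R : realType) (TX TY TZ : finType).
Notation N := #|{: TX * TY * TZ}|.
Variable pxz : TX -> TZ -> R.
Hypothesis pxz_ge0 : forall x z, 0 <= pxz x z.
Hypothesis pxz_sum1 : forall z, \sum_x pxz x z = 1.

(** The vector of the theorem as a function of the resampled path [x] and of the
    data path [u], with each summand centred separately. *)
Definition resample_vec n (x : {ffun 'I_n -> TX}) (u : {ffun 'I_n -> TY * TZ}) : 'cV[R]_N :=
  \col_j let: (x0, y, z) := enum_val j in
    (Num.sqrt n%:R)^-1 *
    \sum_i ((x i == x0)%:R - pxz x0 z) * ((u i).1 == y)%:R * ((u i).2 == z)%:R.

(** The quotients defining the empirical laws cancel: when [n_z] vanishes so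
    does [n_yz], and both sides are 0. *)
Lemma CR_vectorE (O : Type) (Ys : nat -> O -> TY) (Zs : nat -> O -> TZ)
    (Xstar : forall n : nat, 'I_n -> O -> TX) n w :
  CR_vector Ys Zs Xstar pxz n w =
  resample_vec [ffun i => Xstar n i w] [ffun i : 'I_n => (Ys i w, Zs i w)].
Proof.
apply/colP => j; rewrite !mxE; case: (enum_val j) => [[x y] z].
have [->|n0] := posnP n; first by rewrite sqrtr0 invr0 !mul0r.
have nR : (0 : R) < n%:R by rewrite ltr0n.
set s := Num.sqrt n%:R.
have s0 : s != 0 by rewrite gt_eqF // sqrtr_gt0.
have sn : n%:R = s * s by rewrite -expr2 sqr_sqrtr // ltW.
have yzE : phat_y_z R Ys Zs n y z w * phat_z R Zs n z w = (n_yz Ys Zs n y z w)%:R / n%:R.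
  rewrite /phat_y_z /phat_z; have [nz0|nz0] := eqVneq (n_z Zs n z w) 0%N.
    rewrite nz0 invr0 !mul0r mulr0 (_ : n_yz _ _ _ _ _ _ = 0%N) ?mul0r //.
    apply/eqP; rewrite -leqn0 -nz0; apply: leq_sum => i _.
    by case: (Ys i w == y); case: (Zs i w == z).
  by rewrite mulrA divfK // pnatr_eq0.
rewrite -mulrA yzE /phat_star /n_yz natr_sum.
rewrite [in RHS](eq_bigr (fun i : 'I_n =>
  [&& @Xstar n i w == x, Ys i w == y & Zs i w == z]%:R
  - pxz x z * ((Ys i w == y) && (Zs i w == z))%:R)); last first.
  move=> i _; rewrite !ffunE /=.
  by case: (_ == x); case: (_ == y); case: (_ == z); rewrite ?mulr1n ?mulr0n; ring.
rewrite sumrB -mulr_sumr sn; field.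
by rewrite s0.
Qed.

Variable t : 'cV[R]_N.

Definition coef (x : TX) (y : TY) (z : TZ) : R := t (enum_rank (x, y, z)) 0.

Definition cmean (y : TY) (z : TZ) : R := \sum_x pxz x z * coef x y z.

Definition cvar (y : TY) (z : TZ) : R :=
  \sum_x pxz x z * (coef x y z - cmean y z) ^+ 2.

Lemma sum_triple (F : TX -> TY -> TZ -> R) :
  \sum_(v : TX * TY * TZ) F v.1.1 v.1.2 v.2 = \sum_y \sum_z \sum_x F x y z.
Proof.
rewrite -(pair_bigA _ (fun (p : TX * TY) z => F p.1 p.2 z)) /=.
rewrite -(pair_bigA _ (fun x y => \sum_z F x y z)) /= exchange_big /=.
by apply: eq_bigr => y _; rewrite exchange_big.
Qed.

Lemma sum_enum_triple (F : 'I_N -> R) :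
  \sum_j F j = \sum_y \sum_z \sum_x F (enum_rank (x, y, z)).
Proof.
rewrite -(sum_triple (fun x y z => F (enum_rank (x, y, z)))).
rewrite (reindex (@enum_rank (TX * TY * TZ)%type)) /=.
  by apply: eq_bigr => -[[x y] z] _.
by exists enum_val => j _; [exact: enum_rankK|exact: enum_valK].
Qed.

Lemma sum_select (I : finType) (i : I) (F : I -> R) :
  \sum_j (i == j)%:R * F j = F i.
Proof.
rewrite (bigD1 i) //= eqxx mul1r big1 ?addr0 // => j ji.
by rewrite eq_sym (negbTE ji) mul0r.
Qed.

(** The summands are functions of distinct resampled variables: independent,
    and centred under [pxz]. *)
Lemma dot_resample n (x : {ffun 'I_n -> TX}) (u : {ffun 'I_n -> TY * TZ}) :
  dot t (resample_vec x u) =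
  \sum_i (Num.sqrt n%:R)^-1 * (coef (x i) (u i).1 (u i).2 - cmean (u i).1 (u i).2).
Proof.
rewrite dotE sum_enum_triple.
under eq_bigr do under eq_bigr do under eq_bigr do
  rewrite mxE enum_rankK mulrCA mulr_sumr mulr_sumr.
under eq_bigr do under eq_bigr do rewrite exchange_big /=.
under eq_bigr do rewrite exchange_big /=.
rewrite exchange_big /=; apply: eq_bigr => i _.
rewrite (eq_bigr (fun y => ((u i).1 == y)%:R * \sum_z ((u i).2 == z)%:R *
   ((Num.sqrt n%:R)^-1 * (coef (x i) y z - cmean y z)))).
  by rewrite sum_select sum_select.
move=> y _; rewrite mulr_sumr; apply: eq_bigr => z _.
rewrite (_ : coef (x i) y z - cmean y z =
    \sum_a (x i == a)%:R * coef a y z - \sum_a pxz a z * coef a y z); last first.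
  by rewrite sum_select.
rewrite -sumrB !mulr_sumr; apply: eq_bigr => a _; rewrite /coef; ring.
Qed.

Section FixedData.
Variables (ys : nat -> TY) (zs : nat -> TZ) (pyz : TY -> TZ -> R).
Hypothesis freq_cvg : forall y z,
  (\sum_(i < n) ((ys i == y) && (zs i == z))%:R) / n%:R @[n --> \oo] --> pyz y z.

Let q (i : nat) (x : TX) : R := pxz x (zs i).

Let h (n i : nat) (x : TX) : R :=
  (Num.sqrt n%:R)^-1 * (coef x (ys i) (zs i) - cmean (ys i) (zs i)).

Let q_ge0 i x : 0 <= q i x. Proof. exact: pxz_ge0. Qed.
Let q_sum1 i : \sum_x q i x = 1. Proof. exact: pxz_sum1. Qed.

Let h_mean0 n i : \sum_x q i x * h n i x = 0.
Proof.
rewrite (eq_bigr (fun x => (Num.sqrt n%:R)^-1 *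
  (pxz x (zs i) * coef x (ys i) (zs i) - pxz x (zs i) * cmean (ys i) (zs i)))).
  by rewrite -mulr_sumr sumrB -mulr_suml pxz_sum1 mul1r subrr mulr0.
by move=> x _; rewrite /q /h; ring.
Qed.

Let C : R := 2 * \sum_j `|t j 0|.

Let coef_le x y z : `|coef x y z| <= \sum_j `|t j 0|.
Proof.
rewrite /coef (bigD1 (enum_rank (x, y, z))) //= lerDl.
by apply: sumr_ge0.
Qed.

Let C_ge0 : 0 <= C.
Proof. by rewrite mulr_ge0 //; apply: sumr_ge0. Qed.

Let h_le n i x : `|h n i x| <= C / Num.sqrt n%:R.
Proof.
rewrite /h normrM ger0_norm ?invr_ge0 // mulrC ler_wpM2r ?invr_ge0 //.
rewrite (le_trans (ler_normB _ _)) // /C mulr_natl mulr2n lerD //.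
rewrite (le_trans (ler_norm_sum _ _ _)) //.
rewrite -[leRHS]mul1r -(pxz_sum1 (zs i)) mulr_suml; apply: ler_sum => a _.
by rewrite normrM (ger0_norm (pxz_ge0 _ _)) ler_wpM2l.
Qed.

Let paths n : {ffun 'I_n -> TY * TZ} := [ffun i : 'I_n => (ys i, zs i)].

Let dot_paths n (x : {ffun 'I_n -> TX}) :
  dot t (resample_vec x (paths n)) = \sum_(i < n) h n i (x i).
Proof. by rewrite dot_resample; apply: eq_bigr => i _; rewrite !ffunE. Qed.

(** Observations are grouped by their values of [(y, z)]. *)
Let total_var n : \sum_(i < n) \sum_x q i x * h n i x ^+ 2 =
  \sum_y \sum_z (\sum_(i < n) ((ys i == y) && (zs i == z))%:R) / n%:R * cvar y z.
Proof.
transitivity (n%:R^-1 * \sum_(i < n) cvar (ys i) (zs i)).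
  rewrite mulr_sumr; apply: eq_bigr => i _; rewrite mulr_sumr.
  apply: eq_bigr => x _; rewrite /q /h exprMn exprVn sqr_sqrtr //; ring.
have -> : \sum_(i < n) cvar (ys i) (zs i) = \sum_(i < n) \sum_y \sum_z
    ((ys i == y) && (zs i == z))%:R * cvar y z.
  apply: eq_bigr => i _; rewrite -(sum_select (ys i) (fun y => cvar y (zs i))).
  apply: eq_bigr => y _; rewrite -(sum_select (zs i) (cvar y)) mulr_sumr.
  by apply: eq_bigr => z _; rewrite mulrA -natrM mulnb.
rewrite exchange_big mulr_sumr; apply: eq_bigr => y _.
rewrite exchange_big mulr_sumr; apply: eq_bigr => z _.
by rewrite -mulr_suml /=; ring.
Qed.

Let sigma2 : R := \sum_y \sum_z pyz y z * cvar y z.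

Let var_cvg : \sum_(i < n) \sum_x q i x * h n i x ^+ 2 @[n --> \oo] --> sigma2.
Proof.
rewrite (_ : (fun n => _) = fun n => \sum_y \sum_z
  (\sum_(i < n) ((ys i == y) && (zs i == z))%:R) / n%:R * cvar y z); last first.
  by apply/funext => n; rewrite total_var.
rewrite /sigma2; apply: cvg_big => [|y _]; first exact: add_continuous.
apply: cvg_big => [|z _]; first exact: add_continuous.
by apply: cvgMr_tmp; exact: freq_cvg.
Qed.

Let b n : R := C / Num.sqrt n%:R.

Let b_cvg0 : b n @[n --> \oo] --> 0.
Proof.
rewrite -[X in _ --> X](mulr0 C); apply: cvgM (cvg_cst _) _.
rewrite -[X in _ --> X](@sqrtr0 R).
rewrite (_ : (fun n => _) = (fun n => Num.sqrt (n%:R^-1))); last first.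
  by apply/funext => n; rewrite sqrtrV.
apply: continuous_cvg; first exact: sqrt_continuous.
by rewrite -cvg_shiftS; exact: cvg_harmonic.
Qed.

(** [b n] has order [n ^ (-1/2)], so [n * b n ^+ 3] has that order too. *)
Let err_cvg0 : n%:R * (b n ^+ 3 + 2 * b n ^+ 4) @[n --> \oo] --> 0.
Proof.
have bE n : (0 < n)%N -> n%:R * b n ^+ 2 = C ^+ 2.
  move=> n0; rewrite /b expr_div_n sqr_sqrtr // mulrC divfK //.
  by rewrite pnatr_eq0 -lt0n.
have E : \forall n \near \oo,
    C ^+ 2 * (b n + 2 * (b n * b n)) = n%:R * (b n ^+ 3 + 2 * b n ^+ 4).
  by exists 1%N => // n /= n1; rewrite -(bE n n1); ring.
have H : C ^+ 2 * (b n + 2 * (b n * b n)) @[n --> \oo] --> 0.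
  rewrite [X in _ --> X](_ : 0 = C ^+ 2 * (0 + 2 * (0 * 0))); last by ring.
  apply: cvgM (cvg_cst _) _; apply: cvgD => //.
  by apply: cvgM (cvg_cst _) _; apply: cvgM.
exact: cvg_trans (near_eq_cvg E) H.
Qed.

(** The central limit theorem in direction [t]: the replacement error tends to 0
    and the total variance converges with the empirical frequencies. *)
Lemma char_resample_cvg th :
  avg q (fun x : {ffun 'I_n -> TX} => cos (dot t (resample_vec x (paths n)) + th))
    @[n --> \oo] --> cos th * expR (- (sigma2 / 2)).
Proof.
pose v n := \sum_(i < n) \sum_x q i x * h n i x ^+ 2.
pose a n := avg q (fun x : {ffun 'I_n -> TX} => cos (th + \sum_(i < n) h n i (x i))).
rewrite (_ : (fun n => avg _ _) = a); last first.
  apply/funext => n; rewrite /a /avg; apply: eq_bigr => x _.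
  by rewrite dot_paths addrC.
have vE : expR (- (v n / 2)) * cos th @[n --> \oo] --> cos th * expR (- (sigma2 / 2)).
  rewrite mulrC; apply: cvgM; last exact: cvg_cst.
  apply: continuous_cvg; first exact: continuous_expR.
  by apply: cvgN; apply: cvgM; [exact: var_cvg|exact: cvg_cst].
have d0 : a n - expR (- (v n / 2)) * cos th @[n --> \oo] --> 0.
  apply: norm_cvg0.
  apply: (@squeeze_cvgr _ _ _ _ (cst 0) _ _ _ _ _ err_cvg0); last exact: cvg_cst.
  apply: nearW => n; rewrite normr_ge0 /=.
  exact: (avg_cos_bound q_ge0 q_sum1 (h_mean0 n) (h_le n) n th).
rewrite -[X in _ --> X]add0r.
rewrite (_ : a = fun n => (a n - expR (- (v n / 2)) * cos th) + expR (- (v n / 2)) * cos th).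
  exact: cvgD d0 vE.
by apply/funext => n; rewrite subrK.
Qed.

End FixedData.

End Resampling.

(** * Tightness along a fixed data sequence *)

Section Tightness.
Context (R : realType) (TX TY TZ : finType).
Notation N := #|{: TX * TY * TZ}|.
Variable pxz : TX -> TZ -> R.
Hypothesis pxz_ge0 : forall x z, 0 <= pxz x z.
Hypothesis pxz_sum1 : forall z, \sum_x pxz x z = 1.
Variables (ys : nat -> TY) (zs : nat -> TZ).

Let q (i : nat) (x : TX) : R := pxz x (zs i).
Let paths n : {ffun 'I_n -> TY * TZ} := [ffun i : 'I_n => (ys i, zs i)].

Let q_ge0 i x : 0 <= q i x. Proof. exact: pxz_ge0. Qed.
Let q_sum1 i : \sum_x q i x = 1. Proof. exact: pxz_sum1. Qed.

(** Cross terms vanish, and each of the [n] remaining terms is at most [1 / n]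
    because an indicator and its mean differ by at most 1. *)
Lemma resample_coord_var n (k : 'I_N) :
  avg q (fun x : {ffun 'I_n -> TX} =>
    resample_vec pxz x (paths n) k 0 ^+ 2) <= 1.
Proof.
pose e : 'cV[R]_N := delta_mx k 0.
pose h (i : nat) (x : TX) : R := (Num.sqrt n%:R)^-1 *
  (coef e x (ys i) (zs i) - cmean pxz e (ys i) (zs i)).
have c01 x y z : 0 <= coef e x y z <= 1.
  by rewrite /coef mxE eqxx andbT; case: eqP; rewrite /= ?mulr1n ?mulr0n ?lexx ?ler01.
have m01 y z : 0 <= cmean pxz e y z <= 1.
  apply/andP; split.
    by apply: sumr_ge0 => x _; rewrite mulr_ge0 //; have /andP[] := c01 x y z.
  rewrite -(pxz_sum1 z); apply: ler_sum => x _; rewrite -[leRHS]mulr1.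
  by rewrite ler_wpM2l //; have /andP[] := c01 x y z.
rewrite (_ : avg _ _ = avg q (fun x : {ffun 'I_n -> TX} =>
    (0 + \sum_(i < n) h i (x i)) ^+ 2)); last first.
  apply: eq_bigr => x _; congr (_ * _ ^+ 2).
  rewrite add0r -[LHS](_ : dot e (resample_vec pxz x (paths n)) = _).
    by rewrite dot_resample; apply: eq_bigr => i _; rewrite !ffunE.
  rewrite dotE (bigD1 k) //= big1 => [|j jk]; first by rewrite mxE !eqxx mul1r addr0.
  by rewrite mxE (negbTE jk) mul0r.
rewrite avg_sqr //; last first.
  move=> i; rewrite (eq_bigr (fun x => (Num.sqrt n%:R)^-1 *
    (pxz x (zs i) * coef e x (ys i) (zs i) - pxz x (zs i) * cmean pxz e (ys i) (zs i)))).
    by rewrite -mulr_sumr sumrB -mulr_suml pxz_sum1 mul1r subrr mulr0.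
  by move=> x _; rewrite /q /h; ring.
rewrite expr0n add0r.
apply: (@le_trans _ _ (\sum_(i < n) n%:R^-1)).
  apply: ler_sum => i _; apply: (@le_trans _ _ (\sum_x q i x * n%:R^-1)); last first.
    by rewrite -mulr_suml q_sum1 mul1r.
  apply: ler_sum => x _; rewrite ler_wpM2l //.
  rewrite /h exprMn exprVn sqr_sqrtr // -[leRHS]mulr1 ler_wpM2l ?invr_ge0 //.
  have /andP[? ?] := c01 x (ys i) (zs i); have /andP[? ?] := m01 (ys i) (zs i).
  rewrite -(real_normK (num_real _)) exprn_ile1 // ler_norml.
  by apply/andP; split; lra.
rewrite sumr_const card_ord -[leLHS]mulr_natr.
by have [->|n0] := posnP n; rewrite ?mulr0 // mulVf // pnatr_eq0 -lt0n.
Qed.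

(** Chebyshev, uniformly in the sample size. *)
Lemma resample_box_tail n (L : R) : 0 < L ->
  avg q (fun x : {ffun 'I_n -> TX} => \1_(~` box L) (resample_vec pxz x (paths n)))
  <= N%:R / L ^+ 2.
Proof.
move=> L0; have L2 : 0 < L ^+ 2 by rewrite exprn_gt0.
apply: (@le_trans _ _ (avg q (fun x : {ffun 'I_n -> TX} => L ^- 2 *
   \sum_k resample_vec pxz x (paths n) k 0 ^+ 2))).
  apply: ler_avg => // x.
  have S0 : 0 <= \sum_k resample_vec pxz x (paths n) k 0 ^+ 2.
    by apply: sumr_ge0 => k _; exact: sqr_ge0.
  rewrite indicE; case: (boolP (_ \in _)) => [/set_mem /= nb|_]; last first.
    by rewrite mulr_ge0 // invr_ge0 ltW.
  have /existsNP[k /negP] := nb; rewrite -ltNge => Lk.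
  rewrite ler_pdivlMl // mulr1 (bigD1 k) //= -[leLHS]addr0 lerD //.
    by rewrite -[leRHS]real_normK ?num_real // lerXn2r ?nnegrE // ltW.
  by apply: sumr_ge0 => j _; exact: sqr_ge0.
rewrite avgZ avg_sum mulrC ler_wpM2r ?invr_ge0 ?(ltW L2) //.
apply: (@le_trans _ _ (\sum_(k < N) 1)); last by rewrite sumr_const card_ord.
by apply: ler_sum => k _; exact: resample_coord_var.
Qed.

End Tightness.

(** * The limit covariance *)

Section LimitCovariance.
Context (R : realType) (TX TY TZ : finType).
Context (d0 : measure_display) (O0 : measurableType d0) (P0 : probability O0 R).
Variables (X : O0 -> TX) (Y : O0 -> TY) (Z : O0 -> TZ).
Hypotheses (mX : discrete_rv X) (mY : discrete_rv Y) (mZ : discrete_rv Z).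
Hypothesis p_gt0 : forall x y z, 0 < p_xyz P0 X Y Z x y z.
Notation N := #|{: TX * TY * TZ}|.
Notation pxz := (p_x_z P0 X Z).
Local Notation pyz y z := (p_y_z P0 Y Z y z * p_z P0 Z z).

Let mXZ x z : measurable [set w | X w = x /\ Z w = z].
Proof. by apply: (@measurableI _ _ (X @^-1` [set x]) (Z @^-1` [set z])); [exact: mX|exact: mZ]. Qed.

(** A probability space has a point, which supplies the values of [X] and [Y]
    at which the joint mass function can be used. *)
Lemma p_z_gt0 z : 0 < p_z P0 Z z.
Proof.
have [w0 _] : exists w0 : O0, True.
  apply: contrapT => nO; have : P0 setT = 0%E.
    rewrite (_ : setT = set0) ?measure0 // -subset0 => w _.
    by apply: nO; exists w.
  by rewrite probability_setT => /eqP; rewrite onee_eq0.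
apply: lt_le_trans (p_gt0 (X w0) (Y w0) z) _.
have mA : measurable [set w | [/\ X w = X w0, Y w = Y w0 & Z w = z]].
  rewrite (_ : mkset _ = X @^-1` [set X w0] `&` (Y @^-1` [set Y w0] `&` Z @^-1` [set z])).
    by apply: measurableI => //; apply: measurableI.
  by apply/seteqP; split => w /= [? []].
apply: fine_le; rewrite ?fin_num_measure //; try exact: mZ.
by apply: le_measure; rewrite ?inE //; [exact: mZ|move=> w [_ _]].
Qed.

Lemma p_x_z_ge0 x z : 0 <= pxz x z.
Proof. by rewrite /p_x_z divr_ge0 ?fine_ge0. Qed.

Lemma p_x_z_sum1 z : \sum_x pxz x z = 1.
Proof.
rewrite /p_x_z -mulr_suml.
suff -> : \sum_x fine (P0 [set w | X w = x /\ Z w = z]) = p_z P0 Z z.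
  by rewrite mulfV // gt_eqF // p_z_gt0.
rewrite /p_z (probability_partition P0 mX (mZ z)) -sum_fine; last first.
  by move=> x _; rewrite fin_num_measure //; apply: measurableI; [exact: mZ|exact: mX].
by apply: eq_bigr => x _; congr (fine (P0 _)); apply/seteqP; split => w /= [].
Qed.

Lemma p_yzE y z : pyz y z = fine (P0 [set w | Y w = y /\ Z w = z]).
Proof. by rewrite /p_y_z divfK // gt_eqF // p_z_gt0. Qed.

Lemma p_yz_ge0 y z : 0 <= pyz y z.
Proof. by rewrite p_yzE fine_ge0. Qed.

Lemma cvarE (t : 'cV[R]_N) y z :
  cvar pxz t y z = \sum_x pxz x z * coef t x y z ^+ 2 - cmean pxz t y z ^+ 2.
Proof.
rewrite /cvar (eq_bigr (fun x => pxz x z * coef t x y z ^+ 2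
   - 2 * cmean pxz t y z * (pxz x z * coef t x y z)
   + cmean pxz t y z ^+ 2 * pxz x z)) => [|x _]; last by ring.
by rewrite big_split sumrB /= -!mulr_sumr p_x_z_sum1 -/(cmean pxz t y z); ring.
Qed.

(** [Sigma_tilde] is block diagonal in [(y, z)], and its block is the
    covariance matrix of the indicator vector of one draw from [pxz ^~ z], scaled
    by the mass of [(y, z)]. *)
Lemma Sigma_quadratic (t : 'cV[R]_N) :
  (t^T *m Sigma_tilde P0 X Y Z *m t) 0 0 = \sum_y \sum_z pyz y z * cvar pxz t y z.
Proof.
rewrite mxE sum_enum_triple; apply: eq_bigr => y _; apply: eq_bigr => z _.
rewrite (eq_bigr (fun x => (pyz y z * (pxz x z * coef t x y z)
   - pyz y z * cmean pxz t y z * pxz x z) * coef t x y z)).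
  rewrite cvarE.
  rewrite (eq_bigr (fun x => pyz y z * (pxz x z * coef t x y z ^+ 2)
   - pyz y z * cmean pxz t y z * (pxz x z * coef t x y z))) => [|x _]; last by ring.
  by rewrite sumrB -!mulr_sumr -/(cmean pxz t y z); ring.
move=> x _; rewrite -/(coef t x y z); congr (_ * _).
rewrite mxE sum_enum_triple.
rewrite (eq_bigr (fun y' => (y == y')%:R * \sum_z' (z == z')%:R *
  \sum_x' ((x == x')%:R * (pyz y z * (pxz x z * coef t x' y' z')) -
           pyz y z * pxz x z * (pxz x' z' * coef t x' y' z')))); last first.
  move=> y' _; rewrite mulr_sumr; apply: eq_bigr => z' _.
  rewrite mulrA -natrM mulnb mulr_sumr; apply: eq_bigr => x' _.
  rewrite !mxE !enum_rankK /Sigma_tilde_entry -/(coef t x' y' z').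
  rewrite [y' == y]eq_sym [z' == z]eq_sym [x' == x]eq_sym.
  case: (boolP ((y == y') && (z == z'))) => [/andP[/eqP <- /eqP <-]|_].
    2: by rewrite !(mul0r, mulr0).
  by case: (eqVneq x x') => [<-|_]; rewrite ?mulr1n ?mulr0n; ring.
rewrite sum_select sum_select sumrB sum_select -mulr_sumr -/(cmean pxz t y z).
by ring.
Qed.

Lemma Sigma_sym : (Sigma_tilde P0 X Y Z)^T = Sigma_tilde P0 X Y Z.
Proof.
apply/matrixP => i j; rewrite !mxE /Sigma_tilde_entry.
case: (enum_val i) => [[x y] z]; case: (enum_val j) => [[x' y'] z'].
rewrite [y' == y]eq_sym [z' == z]eq_sym [x' == x]eq_sym.
case: (boolP ((y == y') && (z == z'))) => [/andP[/eqP <- /eqP <-]|_]; last by rewrite !mul0r.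
by case: (eqVneq x x') => [<-|_]; rewrite ?mulr1n ?mulr0n; ring.
Qed.

(** Centred indicator vectors, scaled by the square roots of the masses: the sum
    of their squared projections is a mean of squared deviations, that is, a
    variance. *)
Definition root_vec (v : TX * TY * TZ) : 'cV[R]_N :=
  let: (x, y, z) := v in
  Num.sqrt (pxz x z * pyz y z) *:
    \col_j let: (x', y', z') := enum_val j in
      ((x == x')%:R - pxz x' z') * (y == y')%:R * (z == z')%:R.

Lemma dot_root_vec (t : 'cV[R]_N) x y z :
  dot t (root_vec (x, y, z)) =
  Num.sqrt (pxz x z * pyz y z) * (coef t x y z - cmean pxz t y z).
Proof.
rewrite /root_vec dotZr; congr (_ * _); rewrite dotE sum_enum_triple.
rewrite (eq_bigr (fun y' => (y == y')%:R * \sum_z' (z == z')%:R *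
   (coef t x y' z' - cmean pxz t y' z'))); first by rewrite sum_select sum_select.
move=> y' _; rewrite mulr_sumr; apply: eq_bigr => z' _.
rewrite -(sum_select x (fun x => coef t x y' z')) /cmean -sumrB !mulr_sumr.
by apply: eq_bigr => x' _; rewrite mxE enum_rankK /coef; ring.
Qed.

Lemma Sigma_root (t : 'cV[R]_N) :
  (t^T *m Sigma_tilde P0 X Y Z *m t) 0 0 =
  \sum_(a <- [seq root_vec v | v <- index_enum (TX * TY * TZ)%type]) dot t a ^+ 2.
Proof.
rewrite Sigma_quadratic big_map.
pose F x y z := pyz y z * (pxz x z * (coef t x y z - cmean pxz t y z) ^+ 2).
transitivity (\sum_(v : TX * TY * TZ) F v.1.1 v.1.2 v.2).
  rewrite (sum_triple F); apply: eq_bigr => y _; apply: eq_bigr => z _.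
  by rewrite mulr_sumr.
apply: eq_bigr => -[[x y] z] _; rewrite dot_root_vec exprMn sqr_sqrtr.
  by rewrite /F /=; ring.
by rewrite mulr_ge0 ?p_x_z_ge0 ?p_yz_ge0.
Qed.

End LimitCovariance.

(** * Conditional randomisation *)

Section ConditionalRandomisation.
Context (R : realType) (TX TY TZ : finType).
Context (d0 : measure_display) (O0 : measurableType d0) (P0 : probability O0 R).
Variables (X : O0 -> TX) (Y : O0 -> TY) (Z : O0 -> TZ).
Hypotheses (mX : discrete_rv X) (mY : discrete_rv Y) (mZ : discrete_rv Z).
Hypothesis p_gt0 : forall x y z, 0 < p_xyz P0 X Y Z x y z.
Context (dO : measure_display) (O : measurableType dO) (P : probability O R).
Variables (Xs : nat -> O -> TX) (Ys : nat -> O -> TY) (Zs : nat -> O -> TZ).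
Variable Xstar : forall n : nat, 'I_n -> O -> TX.
Let data i : O -> TX * TY * TZ := triple (Xs i) (Ys i) (Zs i).
Hypothesis iid : iid_copies P0 P (triple X Y Z) data.
Local Notation G := (data_events data).
Local Notation pxz := (p_x_z P0 X Z).
Local Notation pyz y z := (p_y_z P0 Y Z y z * p_z P0 Z z).
Hypothesis CR : CR_scheme P G pxz Zs Xstar.

Lemma data_sigma_measurable (D : set O) : <<s G >> D -> measurable D.
Proof.
apply: smallest_sub; first exact: sigma_algebra_measurable.
by move=> _ [i [v ->]]; have [mW _ _] := iid; exact: mW.
Qed.

Let YZ_sigma i y z : <<s G >> [set w | Ys i w = y /\ Zs i w = z].
Proof.
rewrite (_ : mkset _ = \bigcup_(x in setT) (data i @^-1` [set (x, y, z)])).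
  apply: (@fin_bigcup_measurable _ (g_sigma_algebraType G)) => // x _.
  by apply: sub_sigma_algebra; exists i, (x, y, z).
apply/seteqP; split => [w /= [Yw Zw]|w [x _]].
  by exists (Xs i w) => //; rewrite /data /triple /= Yw Zw.
by rewrite /data /triple /= => -[_ -> ->].
Qed.

(** The strong law applied to the events that [(Ys i, Zs i)] equals [(y, z)];
    finitely many such pairs give a common null set. *)
Lemma frequency_cvg : {ae P, forall w : O, forall y z,
  (\sum_(i < n) ((Ys i w == y) && (Zs i w == z))%:R) / n%:R @[n --> \oo] --> pyz y z}.
Proof.
suff H (yz : TY * TZ) : {ae P, forall w : O,
    (\sum_(i < n) ((Ys i w == yz.1) && (Zs i w == yz.2))%:R) / n%:R
      @[n --> \oo] --> pyz yz.1 yz.2}.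
  by apply: filterS (filter_forall _ H) => w Hw y z; exact: (Hw (y, z)).
case: yz => y z /=.
have [_ law indep] := iid.
pose B : set (TX * TY * TZ) := [set v | v.1.2 = y /\ v.2 = z].
pose A i := data i @^-1` B.
have mA i : measurable (A i) by apply: data_sigma_measurable; exact: YZ_sigma.
have PA i : P (A i) = (pyz y z)%:E.
  rewrite /A law (p_yzE mX mY mZ p_gt0) fineK // fin_num_measure //.
  by apply: (@measurableI _ _ (Y @^-1` [set y]) (Z @^-1` [set z])); [exact: mY|exact: mZ].
have PAA i j : i != j -> P (A i `&` A j) = (pyz y z * pyz y z)%:E.
  move=> ij; have := indep [:: i; j] (fun=> B).
  rewrite /= inE ij => /(_ isT).
  rewrite big_cons big_seq1 -/(A i) -/(A j) !PA -EFinM => <-.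
  congr (P _); apply/seteqP; split => [w [Ai Aj] k /=|w H].
    by rewrite !inE => /orP[/eqP->|/eqP->].
  by split; apply: H; rewrite /= !inE eqxx ?orbT.
have := strong_law_events mA PA PAA; apply: filterS => w.
rewrite (_ : (fun n => _) = (fun n => (\sum_(i < n) \1_(A i) w) / n%:R)) //.
apply/funext => n; congr (_ / _); apply: eq_bigr => i _; rewrite indicE.
congr (nat_of_bool _)%:R; apply/idP/idP => [/andP[/eqP Yw /eqP Zw]|].
  by apply/mem_set; split.
by move=> /set_mem [/= -> ->]; rewrite !eqxx.
Qed.

Section SampleSize.
Variable n : nat.

Definition sample_YZ (w : O) : {ffun 'I_n -> TY * TZ} := [ffun i : 'I_n => (Ys i w, Zs i w)].
Definition sample_Xstar (w : O) : {ffun 'I_n -> TX} := [ffun i => Xstar i w].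
Definition path_weight (u : {ffun 'I_n -> TY * TZ}) (x : {ffun 'I_n -> TX}) : R :=
  \prod_i pxz (x i) (u i).2.

Lemma CR_vector_sample :
  CR_vector Ys Zs Xstar pxz n = fun w => resample_vec pxz (sample_Xstar w) (sample_YZ w).
Proof. by apply/funext => w; rewrite CR_vectorE. Qed.

Lemma sample_YZ_sigma u : <<s G >> (sample_YZ @^-1` [set u]).
Proof.
rewrite (_ : _ @^-1` _ = [set w | forall i : 'I_n, Ys i w = (u i).1 /\ Zs i w = (u i).2]).
  by apply: (@measurable_forall _ (g_sigma_algebraType G)) => i; exact: YZ_sigma.
apply/seteqP; split => [w /= <- i|w /= H]; first by rewrite ffunE.
by apply/ffunP => i; rewrite ffunE; have [-> ->] := H i; rewrite -surjective_pairing.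
Qed.

Lemma sample_Xstar_discrete : discrete_rv sample_Xstar.
Proof.
move=> x; have [mXs _ _] := CR n.
rewrite (_ : _ @^-1` _ = [set w | forall i, Xstar i w = x i]).
  by apply: measurable_forall => i; exact: mXs.
apply/seteqP; split => [w /= <- i|w /= H]; first by rewrite ffunE.
by apply/ffunP => i; rewrite ffunE.
Qed.

Lemma path_weight_ge0 u x : 0 <= path_weight u x.
Proof. by apply: prodr_ge0 => i _; exact: p_x_z_ge0. Qed.

Lemma path_weight_sum1 u : \sum_x path_weight u x = 1.
Proof.
rewrite /path_weight -(bigA_distr_bigA (fun i a => pxz a (u i).2)) big1 // => i _.
exact: (p_x_z_sum1 mX mY mZ p_gt0).
Qed.

(** This is the conditional independence of the resampled variables, used with
    the versions [pxz x (Zs i w)] of their conditional laws. *)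
Lemma path_weight_cond x :
  is_cond_prob P G (sample_Xstar @^-1` [set x]) (fun w => path_weight (sample_YZ w) x).
Proof.
have [_ marg joint] := CR n.
have := joint (fun i a w => pxz a (Zs i w)) marg x.
congr is_cond_prob; first apply/seteqP; first split => [w /= H|w /= <- i].
- by apply/ffunP => i; rewrite ffunE.
- by rewrite ffunE.
by apply/funext => w; apply: eq_bigr => i _; rewrite ffunE.
Qed.

End SampleSize.

(** Outside one null set, all versions are integrated as the explicit mixtures
    and the empirical frequencies converge; both parts of the criterion for weak
    convergence are then statements about averages over resampled paths. *)
Lemma CR_cond_cvg (mu : probability (borel_cV R #|{: TX * TY * TZ}|) R) :
  (forall t th, \int[mu]_v cos (dot t v + th) =
     cos th * expR (- ((t^T *m Sigma_tilde P0 X Y Z *m t) 0 0 / 2))) ->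
  cond_cvg_dist P G (CR_vector Ys Zs Xstar pxz) mu.
Proof.
move=> mu_char; split.
  have /choice[kappa kE] : forall n, exists kappa : R.-pker (g_sigma_algebraType G)
      ~> (borel_cV R #|{: TX * TY * TZ}|),
      is_cond_law P (CR_vector Ys Zs Xstar pxz n) kappa.
    move=> n; rewrite CR_vector_sample.
    exact: (cond_law_exists data_sigma_measurable (@resample_vec R TX TY TZ pxz n)
      (@sample_YZ_sigma n) (@sample_Xstar_discrete n) (@path_weight_ge0 n)
      (@path_weight_sum1 n) (@path_weight_cond n)).
  by exists kappa.
move=> kappa kE.
have ae1 : {ae P, forall w : O, forall n (f : 'cV[R]_#|{: TX * TY * TZ}| -> R) M,
    measurable_fun setT (f : borel_cV R _ -> R) -> (forall v, `|f v| <= M) ->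
    \int[kappa n w]_v f v = \sum_x path_weight (sample_YZ n w) x *
      f (resample_vec pxz x (sample_YZ n w))}.
  apply/ae_foralln => n; have := kE n; rewrite CR_vector_sample.
  exact: (cond_law_integral data_sigma_measurable (vec := @resample_vec R TX TY TZ pxz n)
      (@sample_YZ_sigma n) (@sample_Xstar_discrete n) (@path_weight_ge0 n)
      (@path_weight_sum1 n) (@path_weight_cond n)).
apply: filterS2 ae1 frequency_cvg => w kI freq.
have pE n (f : 'cV[R]_#|{: TX * TY * TZ}| -> R) :
    \sum_x path_weight (sample_YZ n w) x * f (resample_vec pxz x (sample_YZ n w)) =
    avg (fun i a => pxz a (Zs i w)) (fun x : {ffun 'I_n -> TX} =>
      f (resample_vec pxz x [ffun i : 'I_n => (Ys i w, Zs i w)])).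
  apply: eq_bigr => x _; congr (_ * _); apply: eq_bigr => i _.
  by rewrite ffunE.
have p0 := p_x_z_ge0 P0 X Z; have p1 := p_x_z_sum1 mX mY mZ p_gt0.
apply: char_weak_cvg => [n||t th|e e0].
- exact: (@prob_kernel _ _ _ _ _ (kappa n) w).
- exact: probability_setT.
- rewrite mu_char Sigma_quadratic //.
  rewrite (_ : (fun n => _) = fun n => avg (fun i a => pxz a (Zs i w))
    (fun x : {ffun 'I_n -> TX} => cos (dot t (resample_vec pxz x
      [ffun i : 'I_n => (Ys i w, Zs i w)]) + th))).
    exact: (@char_resample_cvg R TX TY TZ pxz p0 p1 t
      (fun i => Ys i w) (fun i => Zs i w) _ freq th).
  apply/funext => n; rewrite -(pE n (fun v => cos (dot t v + th))).
  apply: (kI n _ 1); last by move=> v; rewrite ler_norml cos_geN1 cos_le1.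
  exact: continuous_measurable_cV (trigpoly_continuous (trigpoly_cos t th)).
- pose N : R := #|{: TX * TY * TZ}|%:R.
  (* With L >= 1 and L >= N / e, one has N / L^2 <= e. *)
  pose L := N / e + 1.
  have L1 : 1 <= L by rewrite lerDr divr_ge0 // ltW.
  have L0 : 0 < L by exact: lt_le_trans L1.
  exists L => n.
  have mB : measurable (~` @box R #|{: TX * TY * TZ}| L).
    by apply: measurableC; exact: box_measurable.
  have -> : fine (kappa n w (~` box L)) = \int[kappa n w]_v \1_(~` box L) v.
    by rewrite /Rintegral integral_indic // setIT.
  rewrite (kI n _ 1); last 2 first.
  - exact: measurable_indic.
  - by move=> v; rewrite indicE; case: (_ \in _); rewrite ?normr1 ?normr0.
  rewrite pE; apply: le_trans (resample_box_tail p0 p1 (fun i => Ys i w) (fun i => Zs i w) n L0) _.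
  rewrite ler_pdivrMr ?exprn_gt0 //.
  apply: (@le_trans _ _ (e * L)).
    by rewrite /L mulrDr mulr1 mulrCA divff ?gt_eqF // mulr1 lerDl ltW.
  by rewrite ler_wpM2l ?(ltW e0) // expr2 -[leLHS]mulr1 ler_wpM2l // ltW.
Qed.

End ConditionalRandomisation.

Theorem theorem5 (R : realType) (TX TY TZ : finType)
    (* the random triple (X, Y, Z) *)
    (d0 : measure_display) (O0 : measurableType d0) (P0 : probability O0 R)
    (X : O0 -> TX) (Y : O0 -> TY) (Z : O0 -> TZ)
    (mX : discrete_rv X) (mY : discrete_rv Y) (mZ : discrete_rv Z)
    (p_gt0 : forall x y z, 0 < p_xyz P0 X Y Z x y z)
    (* the data and the resampled variables *)
    (dO : measure_display) (O : measurableType dO) (P : probability O R)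
    (Xs : nat -> O -> TX) (Ys : nat -> O -> TY) (Zs : nat -> O -> TZ)
    (Xstar : forall n : nat, 'I_n -> O -> TX)
    (data := fun i => triple (Xs i) (Ys i) (Zs i))
    (iid : iid_copies P0 P (triple X Y Z) data)
    (CR : CR_scheme P (data_events data) (p_x_z P0 X Z) Zs Xstar) :
  exists mu : probability (borel_cV R #|{: TX * TY * TZ}|) R,
    is_mvnormal mu 0 (Sigma_tilde P0 X Y Z) /\
    cond_cvg_dist P (data_events data)
      (CR_vector Ys Zs Xstar (p_x_z P0 X Z)) mu.
Proof.
have [mu [mu_normal mu_char]] := mvnormal_exists (Sigma_sym P0 X Y Z)
  (Sigma_root mX mY mZ p_gt0).
by exists mu; split => //; exact: (CR_cond_cvg mX mY mZ p_gt0 iid CR mu_char).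
Qed.
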